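(* Let $X$ be a Banach space such that $X^*$ satisfies the metric $\pi$-property and let $Y$ be a Banach space. (a) If $Y$ satisfies the metric $\pi$-property, then $\overline{\operatorname{NA}_{\mathcal{N}}(X,Y)}^{\|\cdot\|_N}=\mathcal{N}(X,Y)$. (b) If $Y$ is uniformly convex, then $\overline{\operatorname{NA}_{\mathcal{N}}(X,Y)}^{\|\cdot\|_N}=\mathcal{N}(X,Y)$.
   Context: Banach spaces are over $\mathbb{K}\in\{\mathbb{R},\mathbb{C}\}$. A Banach space $Z$ has the metric $\pi$-property if for every $\varepsilon>0$ and every finite collection $\{z_1,\ldots,z_n\}\subseteq S_Z$ of points of the unit sphere there is a finite dimensional $1$-complemented subspace $M\subseteq Z$ (i.e. $M$ is the range of a linear projection on $Z$ of norm at most $1$) such that for each $i\in\{1,\ldots,n\}$ there exists $z_i'\in M$ with $\|z_i-z_i'\|<\varepsilon$. $\mathcal{N}(X,Y)$ is the space of nuclear operators, i.e. operators of the form $T(x)=\sum_{n=1}^\infty x_n^*(x)y_n$ (written $T=\sum_n x_n^*\otimes y_n$) with $(x_n^* )\subseteq X^*$, $(y_n)\subseteq Y$ bounded and $\sum_n\|x_n^*\|\|y_n\|<\infty$; the nuclear norm $\|T\|_N$ is the infimum of $\sum_n\|x_n^*\|\|y_n\|$ over all such representations. $\operatorname{NA}_{\mathcal{N}}(X,Y)$ is the set of $T\in\mathcal{N}(X,Y)$ which attain their nuclear norm, i.e. for which there is such a representation with $\|T\|_N=\sum_n\|x_n^*\|\|y_n\|$. *)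

(* Defs.v *)
From HB Require Import structures.
From mathcomp Require Import all_boot all_order all_algebra.
From mathcomp Require Import all_classical all_reals all_analysis.
From mathcomp Require Import complex.

Set Implicit Arguments.
Unset Strict Implicit.
Unset Printing Implicit Defensive.

Import Order.TTheory GRing.Theory Num.Theory.
Import numFieldNormedType.Exports.

Local Open Scope classical_set_scope.
Local Open Scope ring_scope.

Variant scalars := RealScalars | ComplexScalars.

Definition scalar_field (R : realType) (s : scalars) : numFieldType :=
  match s with RealScalars => R | ComplexScalars => R[i] end.

(* Norms of normed modules over [scalar_field R s] take their values in
   [scalar_field R s], where [0 <= a] forces [a] to be real.  The maps [re] and
   [of_real] convert between these nonnegative scalars and nonnegative
   elements of [R]. *)
Definition re (R : realType) (s : scalars) : scalar_field R s -> R :=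
  match s with RealScalars => fun a => a | ComplexScalars => @complex.Re R end.

Definition of_real (R : realType) (s : scalars) : R -> scalar_field R s :=
  match s with
  | RealScalars => fun r => r
  | ComplexScalars => fun r => Complex r 0
  end.
Arguments of_real {R} s.

Section ScalarTheory.
Context (R : realType) (s : scalars).
Local Notation K := (scalar_field R s).

Lemma of_realK : cancel (of_real s) (@re R s).
Proof. by case: s. Qed.

Lemma reK (a : K) : 0 <= a -> of_real s (re a) = a.
Proof.
case: s a => //= -[a b]; rewrite lecE /= => /andP[/eqP-> _].
by [].
Qed.

Lemma of_real_le (x y : R) : (of_real s x <= of_real s y) = (x <= y).
Proof. by case: s => //=; rewrite lecE /= eqxx. Qed.

Lemma of_real_lt (x y : R) : (of_real s x < of_real s y) = (x < y).
Proof. by case: s => //=; rewrite ltcE /= eqxx. Qed.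

Lemma of_realD (x y : R) : of_real s (x + y) = of_real s x + of_real s y.
Proof. by case: s => //=; rewrite -[RHS]/(Complex (x + y) (0 + 0)) addr0. Qed.

Lemma of_realM (x y : R) : of_real s (x * y) = of_real s x * of_real s y.
Proof.
case: s => //=.
by rewrite -[RHS]/(Complex (x * y - 0 * 0) (x * 0 + 0 * y)) !(mul0r, mulr0) subr0 addr0.
Qed.

Lemma of_real0 : of_real s (0 : R) = 0.
Proof. by case: s. Qed.

Lemma re_le (a b : K) : 0 <= a -> a <= b -> re a <= re b.
Proof.
move=> a0 ab; rewrite -of_real_le !reK//.
exact: le_trans ab.
Qed.

Lemma re_ge0 (a : K) : 0 <= a -> 0 <= re a.
Proof. by move=> a0; rewrite -of_real_le of_real0 reK. Qed.

End ScalarTheory.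

(* Bounded (equivalently, continuous) linear operators with the operator
   norm. *)
Section BoundedOperators.
Context (R : realType) (s : scalars).
Local Notation K := (scalar_field R s).
Context (X Y : normedModType K).

Definition bounded_op_pred : {pred (X -> Y)} :=
  mem [set T : X -> Y | linear T /\ continuous T].

Record bounded_op := BoundedOp {
  bounded_op_fun :> X -> Y;
  bounded_op_subproof : bounded_op_fun \in bounded_op_pred
}.

HB.instance Definition _ := [isSub for bounded_op_fun].
HB.instance Definition _ := [Choice of bounded_op by <:].

Lemma bounded_op_linear (T : bounded_op) : linear T.
Proof. by case: T => T /=; rewrite inE => -[]. Qed.

Lemma bounded_op_continuous (T : bounded_op) : continuous T.
Proof. by case: T => T /=; rewrite inE => -[]. Qed.

HB.instance Definition _ (T : bounded_op) :=
  GRing.isLinear.Build K X Y *:%R (T : X -> Y) (bounded_op_linear T).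

Lemma bounded_op_submod_closed : submod_closed bounded_op_pred.
Proof.
split=> [|a f g]; rewrite !inE.
  split=> [a x y|x]; first by rewrite /= scaler0 addr0.
  exact: cst_continuous.
move=> [lf cf] [lg cg]; split=> [b x y|x].
  rewrite -[LHS]/(a *: f (b *: x + y) + g (b *: x + y)).
  rewrite -[RHS]/(b *: (a *: f x + g x) + (a *: f y + g y)).
  by rewrite lf lg !scalerDr !scalerA (mulrC a b) addrACA.
apply: continuousD; last exact: cg.
by apply: continuousZ; [exact: cst_continuous|exact: cf].
Qed.

HB.instance Definition _ :=
  GRing.isSubmodClosed.Build K (X -> Y) bounded_op_pred
    bounded_op_submod_closed.
HB.instance Definition _ := [SubChoice_isSubLmodule of bounded_op by <:].

Definition opnorm (T : bounded_op) : R :=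
  sup [set re `|T x| | x in [set x | `|x| <= 1]].


Lemma has_sup_opnorm (T : bounded_op) :
  has_sup [set re `|T x| | x in [set x | `|x| <= 1]].
Proof.
split; first by exists (re `|T 0|), 0 => //=; rewrite normr0 ler01.
have /linear_bounded_continuous/linear_boundedP := @bounded_op_continuous T.
move=> /pinfty_ex_gt0[M M0 TM]; exists (re M) => _ /= [x x1 <-].
apply: re_le => //; apply: le_trans (TM x) _.
by rewrite -[leRHS]mulr1 ler_wpM2l// ltW.
Qed.

Lemma opnorm_ub (T : bounded_op) (x : X) :
  `|x| <= 1 -> re `|T x| <= opnorm T.
Proof. by move=> x1; apply: ub_le_sup; [case: (has_sup_opnorm T)|exists x]. Qed.

Lemma opnorm_le (T : bounded_op) (r : R) :
  (forall x, `|x| <= 1 -> re `|T x| <= r) -> opnorm T <= r.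
Proof.
move=> Tr; apply: ge_sup; first by case: (has_sup_opnorm T).
by move=> _ [x x1 <-]; exact: Tr.
Qed.

Lemma opnorm_ge0 (T : bounded_op) : 0 <= opnorm T.
Proof.
apply: (@le_trans _ _ (re `|T 0|)); first exact: re_ge0.
by apply: opnorm_ub; rewrite normr0 ler01.
Qed.

Lemma opnormP (T : bounded_op) (x : X) :
  `|T x| <= of_real s (opnorm T) * `|x|.
Proof.
have [->|x0] := eqVneq x 0; first by rewrite linear0 !normr0 mulr0.
have nx0 : 0 < `|x| by rewrite normr_gt0.
rewrite -ler_pdivrMr// -[leLHS](reK (divr_ge0 _ _))// of_real_le.
have -> : `|T x| / `|x| = `|T (`|x|^-1 *: x)|.
  by rewrite linearZ normrZ normfV normr_id mulrC.
by apply: opnorm_ub; rewrite normrZ normfV normr_id mulVf// normr_eq0.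
Qed.

Let norm (T : bounded_op) : K := of_real s (opnorm T).

Let norm_le (T : bounded_op) (a : K) : 0 <= a ->
  (forall x, `|x| <= 1 -> `|T x| <= a) -> norm T <= a.
Proof.
move=> a0 Ta; rewrite -[leRHS](reK a0) of_real_le.
by apply: opnorm_le => x x1; apply: re_le => //; exact: Ta.
Qed.

Let norm_ge0 (T : bounded_op) : 0 <= norm T.
Proof. by rewrite -(of_real0 R s) of_real_le opnorm_ge0. Qed.

Let norm_ub (T : bounded_op) (x : X) : `|x| <= 1 -> `|T x| <= norm T.
Proof.
move=> x1; apply: le_trans (opnormP T x) _.
rewrite -[leRHS]mulr1; apply: ler_wpM2l => //; exact: norm_ge0.
Qed.

Let ler_norm_bopD (S T : bounded_op) : norm (S + T) <= norm S + norm T.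
Proof.
apply: norm_le => [|x x1]; first by apply: addr_ge0; exact: norm_ge0.
by apply: le_trans (ler_normD _ _) _; apply: lerD; exact: norm_ub.
Qed.

Let norm_bopZ_le (a : K) (T : bounded_op) : norm (a *: T) <= `|a| * norm T.
Proof.
apply: norm_le => [|x x1]; first by apply: mulr_ge0; [exact: normr_ge0|exact: norm_ge0].
by rewrite [X in `|X|]/(a *: T x) normrZ ler_wpM2l// norm_ub.
Qed.

Let norm_bopZ (a : K) (T : bounded_op) : norm (a *: T) = `|a| * norm T.
Proof.
have [->|a0] := eqVneq a 0.
  apply/le_anti; rewrite norm_bopZ_le/=.
  by rewrite normr0 mul0r.
apply/le_anti; rewrite norm_bopZ_le/=.
rewrite -ler_pdivlMl ?normr_gt0// -normfV.
by rewrite -{1}(scalerK a0 T) norm_bopZ_le.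
Qed.

Let norm_bop0_eq0 (T : bounded_op) : norm T = 0 -> T = 0.
Proof.
move=> T0; apply/val_inj/funext => x /=.
apply/eqP; rewrite -normr_le0.
by apply: le_trans (opnormP T x) _; rewrite -/(norm T) T0 mul0r.
Qed.

HB.instance Definition _ := Lmodule_isNormed.Build K bounded_op
  ler_norm_bopD norm_bopZ norm_bop0_eq0.

Lemma normr_bounded_op (T : bounded_op) : `|T| = of_real s (opnorm T).
Proof. by []. Qed.

End BoundedOperators.

Section Notions.
Context (R : realType) (s : scalars).
Local Notation K := (scalar_field R s).

Definition dual (X : normedModType K) : normedModType K :=
  bounded_op X (K^o : normedModType K).

Definition finite_dim_subspace (Z : normedModType K) (M : set Z) :=
  exists (d : nat) (e : 'I_d -> Z),
    M = [set \sum_(i < d) c i *: e i | c in [set: 'I_d -> K]].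

Definition one_complemented (Z : normedModType K) (M : set Z) :=
  exists P : bounded_op Z Z,
    [/\ forall z, P (P z) = P z, `|P| <= 1 & M = range P].

(* [0 < eps] in [K] means that [eps] is a positive real number. *)
Definition metric_pi_property (Z : normedModType K) :=
  forall (eps : K) (n : nat) (z : 'I_n -> Z),
    0 < eps -> (forall i, `|z i| = 1) ->
    exists M : set Z, [/\ finite_dim_subspace M, one_complemented M &
      forall i, exists2 z', M z' & `|z i - z'| < eps].

Definition uniformly_convex (Y : normedModType K) :=
  forall eps : K, 0 < eps -> exists2 delta : K, 0 < delta &
    forall x y : Y, `|x| = 1 -> `|y| = 1 -> eps <= `|x - y| ->
      `|2^-1 *: (x + y)| <= 1 - delta.

Section Nuclear.
Context (X Y : normedModType K).

Definition representation_sum (f : nat -> dual X) (y : nat -> Y) : \bar R :=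
  (\sum_(0 <= n <oo) (re (`|f n| * `|y n|))%:E)%E.

Definition nuclear_representation
    (T : bounded_op X Y) (f : nat -> dual X) (y : nat -> Y) :=
  [/\ bounded_fun f, bounded_fun y, (representation_sum f y < +oo)%E &
    forall x : X, series (fun n => (f n x : K) *: y n) @ \oo --> T x].

Definition nuclear : set (bounded_op X Y) :=
  [set T | exists f y, nuclear_representation T f y].

(* Equal to [+oo] outside [nuclear]. *)
Definition nuclear_norm (T : bounded_op X Y) : \bar R :=
  ereal_inf [set t | exists f y,
    nuclear_representation T f y /\ t = representation_sum f y].

Definition nuclear_norm_attaining : set (bounded_op X Y) :=
  [set T | exists f y,
    nuclear_representation T f y /\ nuclear_norm T = representation_sum f y].

(* The closure of [A] in the space of nuclear operators for the nuclear norm. *)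
Definition nuclear_closure (A : set (bounded_op X Y)) : set (bounded_op X Y) :=
  [set T | nuclear T /\ forall eps : R, 0 < eps ->
    exists2 S, A S & (nuclear_norm (T - S)%R < eps%:E)%E].

End Nuclear.
End Notions.

(* Main.v *)
From HB Require Import structures.
Require Import Defs.
From mathcomp Require Import all_boot all_order all_algebra.
From mathcomp Require Import all_classical all_reals all_analysis.
From mathcomp Require Import complex ring lra.

(** Write [f (x) y] for the rank-one operator [tensor f y].  By the metric
    pi-property, every nuclear operator is, up to a small nuclear norm, a finite
    sum [T] of operators [m_k (x) v_k] with the [m_k] in a finite-dimensional
    1-complemented subspace [M] of the dual of [X] and the [v_k] in a
    1-complemented subspace [N] of [Y]; in (a) [N] is finite-dimensional too, in
    (b) it is all of [Y].  It remains to approximate [T] by operators that attain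
    their nuclear norm ([finite_tensor_approx]).

    - Projecting the entries of any representation of [T] onto [M] and [N] gives
      again a representation of [T], with no larger weight
      ([represents_projected]).  So almost optimal representations of [T] can be
      found with all entries in [M] and [N].

    - Let [u] be a real-linear functional bounded by the nuclear norm and equal
      to it at [T] ([hahn_banach]).  In an almost optimal representation, the
      terms [f (x) y] for which [u (f (x) y)] is not close to [|f| |y|] have
      small total weight.  For the others, [attainment_stable] provides, after
      normalisation, a nearby pair [(f', y')] with [u (f' (x) y') = 1].  It is a
      compactness statement: unit vectors of [M] accumulate, and for a fixed [f]
      a maximising sequence for [u (f (x) _)] in the unit sphere of [N]
      converges, by compactness in (a) and by uniform convexity in (b).

    - Finitely many terms suffice up to a small error.  Replace the good ones by
      the exactly normed pairs, drop the bad ones, and call [S] the sum.  Then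
      [S] is close to [T], and [u S] is the weight of this representation of
      [S], which is therefore optimal.

    Compactness is used along ultrafilters on [nat]: bounded sequences in a
    finite-dimensional space converge along each of them, so that no
    subsequence has to be extracted. *)

Set Implicit Arguments.
Unset Strict Implicit.
Unset Printing Implicit Defensive.

Import Order.TTheory GRing.Theory Num.Theory.
Import numFieldNormedType.Exports.

Local Open Scope classical_set_scope.
Local Open Scope ring_scope.

(** * Norms read in the real field *)

Section RealNorm.
Context (R : realType) (s : scalars).
Local Notation K := (scalar_field R s).
Local Notation "r %:S" := (of_real s r) (at level 2, format "r %:S").

Lemma of_real_ge0 (r : R) : (0 <= r%:S :> K) = (0 <= r).
Proof. by rewrite -(of_real0 R s) of_real_le. Qed.

Lemma of_real_gt0 (r : R) : (0 < r%:S :> K) = (0 < r).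
Proof. by rewrite -(of_real0 R s) of_real_lt. Qed.

Lemma of_real1 : (1 : R)%:S = 1 :> K.
Proof. by case: s. Qed.

Lemma of_realN (r : R) : (- r)%:S = - r%:S :> K.
Proof. by apply/eqP; rewrite -subr_eq0 opprK -of_realD addNr of_real0. Qed.

Lemma of_realB (x y : R) : (x - y)%:S = x%:S - y%:S :> K.
Proof. by rewrite of_realD of_realN. Qed.

Lemma of_realV (r : R) : (r^-1)%:S = (r%:S)^-1 :> K.
Proof.
have [->|r0] := eqVneq r 0; first by rewrite invr0 of_real0 invr0.
apply: (mulIf (_ : r%:S != 0)); last first.
  rewrite mulVf -?of_realM ?mulVf ?of_real1//.
  by apply: contra r0 => /eqP/(congr1 (@re R s)); rewrite of_realK -(of_real0 R s) of_realK => ->.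
by apply: contra r0 => /eqP/(congr1 (@re R s)); rewrite of_realK -(of_real0 R s) of_realK => ->.
Qed.

Lemma norm_of_real (r : R) : `|r%:S| = `|r|%:S :> K.
Proof.
have [r0|r0] := leP 0 r; first by rewrite !ger0_norm ?of_real_ge0.
by rewrite !ltr0_norm ?of_realN// -(of_real0 R s) of_real_lt.
Qed.

(** Norms take their values in the nonnegative reals of [K], which need not
    be totally ordered; [rnorm] reads them in [R]. *)
Definition rnorm (V : normedModType K) (x : V) : R := re `|x|.

Section Basic.
Context (V : normedModType K).
Implicit Types x y : V.

Lemma rnormE x : `|x| = (rnorm x)%:S.
Proof. by rewrite /rnorm reK. Qed.

Lemma rnorm_ge0 x : 0 <= rnorm x.
Proof. by rewrite /rnorm re_ge0. Qed.

Lemma ler_rnormD x y : rnorm (x + y) <= rnorm x + rnorm y.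
Proof. by rewrite -(of_real_le s) of_realD -!rnormE ler_normD. Qed.

Lemma rnorm0 : rnorm (0 : V) = 0.
Proof. by rewrite /rnorm normr0 -(of_real0 R s) of_realK. Qed.

Lemma rnormN x : rnorm (- x) = rnorm x.
Proof. by rewrite /rnorm normrN. Qed.

Lemma rnormBC x y : rnorm (x - y) = rnorm (y - x).
Proof. by rewrite /rnorm distrC. Qed.

Lemma ler_rnormB x y : rnorm (x - y) <= rnorm x + rnorm y.
Proof. by rewrite -[rnorm y]rnormN ler_rnormD. Qed.

Lemma ler_rnorm_dist x y : rnorm x - rnorm y <= rnorm (x - y).
Proof. by rewrite lerBlDr (le_trans _ (ler_rnormD _ _))// subrK. Qed.

Lemma rnorm0_eq0 x : rnorm x = 0 -> x = 0.
Proof.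
by move=> x0; apply/eqP; rewrite -normr_eq0 rnormE x0 of_real0.
Qed.

Lemma rnorm_eq0 x : (rnorm x == 0) = (x == 0).
Proof. by apply/eqP/eqP => [/rnorm0_eq0|->]; last exact: rnorm0. Qed.

Lemma rnormZ (a : K) x : rnorm (a *: x) = re `|a| * rnorm x.
Proof.
by apply: (can_inj (@of_realK R s)); rewrite of_realM reK// -!rnormE normrZ.
Qed.

Lemma rnormZr (r : R) x : rnorm (r%:S *: x) = `|r| * rnorm x.
Proof. by rewrite rnormZ norm_of_real of_realK. Qed.

Lemma ler_rnorm_sum (I : Type) (r : seq I) (F : I -> V) :
  rnorm (\sum_(i <- r) F i) <= \sum_(i <- r) rnorm (F i).
Proof.
elim/big_rec2: _ => [|i a b _ ba]; first by rewrite rnorm0.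
by rewrite (le_trans (ler_rnormD _ _))// lerD2l.
Qed.

Lemma cvg_rnormP T (F : set_system T) {FF : Filter F} (z : T -> V) (l : V) :
  z @ F --> l <-> forall e : R, 0 < e -> \forall t \near F, rnorm (l - z t) < e.
Proof.
split=> [/cvgrPdist_lt zl e e0|zl].
  have /zl : 0 < e%:S :> K by rewrite of_real_gt0.
  by apply: filterS => t /=; rewrite rnormE of_real_lt.
apply/cvgrPdist_lt => e e0.
have eE := reK (ltW e0).
have /zl : 0 < re e by rewrite -(of_real_gt0) eE.
by apply: filterS => t /=; rewrite rnormE -[X in _ -> _ < X]eE of_real_lt.
Qed.

Lemma unit_rescale x : x != 0 ->
  exists2 w : V, rnorm w = 1 & x = (rnorm x)%:S *: w.
Proof.
move=> x0; have nx0 : rnorm x != 0 by rewrite rnorm_eq0.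
exists ((rnorm x)^-1%:S *: x).
  by rewrite rnormZr ger0_norm ?invr_ge0 ?rnorm_ge0// mulVf.
by rewrite scalerA -of_realM divff// of_real1 scale1r.
Qed.

End Basic.

Lemma scalar_scaleC (a b : K) :
  a *: (b : (K^o : normedModType K)) = b *: (a : (K^o : normedModType K)).
Proof. exact: mulrC. Qed.

Lemma re_mul_norm (V W : normedModType K) (v : V) (w : W) :
  re (`|v| * `|w|) = rnorm v * rnorm w.
Proof. by rewrite !rnormE -of_realM of_realK. Qed.

Section Operators.
Context (V W : normedModType K).

Lemma rnorm_op (T : bounded_op V W) x : rnorm (T x) <= rnorm T * rnorm x.
Proof.
rewrite -(of_real_le s) of_realM -!rnormE; apply: le_trans (opnormP T x) _.
by rewrite normr_bounded_op.
Qed.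

Lemma rnorm_op_le (T : bounded_op V W) (r : R) : 0 <= r ->
  (forall x, rnorm (T x) <= r * rnorm x) -> rnorm T <= r.
Proof.
move=> r0 Tr; rewrite /rnorm normr_bounded_op of_realK.
apply: opnorm_le => x x1; apply: le_trans (Tr x) _.
by rewrite ler_piMr// -(of_real_le s) -rnormE of_real1.
Qed.

Lemma rnorm_contraction (T : bounded_op V W) x : rnorm T <= 1 -> rnorm (T x) <= rnorm x.
Proof.
by move=> T1; rewrite (le_trans (rnorm_op _ _))// ler_piMl// rnorm_ge0.
Qed.

Lemma bounded_opP (f : V -> W) (r : R) : linear f ->
  (forall x, rnorm (f x) <= r * rnorm x) -> f \in @bounded_op_pred R s V W.
Proof.
move=> lf fr; rewrite inE; split=> //.
pose g : {linear V -> W} := HB.pack f (GRing.isLinear.Build K V W *:%R f lf).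
rewrite -[f]/(g : V -> W) => x; apply: bounded_linear_continuous.
apply/linear_boundedP; exists `|r|%:S; split; first by rewrite ger0_real ?of_real_ge0.
move=> M rM v; rewrite rnormE.
have r0 : 0 <= `|r|%:S :> K by rewrite of_real_ge0.
apply: (@le_trans _ _ (`|r|%:S * `|v|)).
  rewrite rnormE -of_realM of_real_le (le_trans (fr v))//.
  by rewrite ler_wpM2r ?rnorm_ge0// ler_norm.
by rewrite ler_wpM2r// ltW.
Qed.

Definition mk_op (f : V -> W) (r : R) (lf : linear f)
  (fr : forall x, rnorm (f x) <= r * rnorm x) : bounded_op V W :=
  BoundedOp (bounded_opP lf fr).

Lemma bounded_op_ext (S T : bounded_op V W) : (forall x, S x = T x) -> S = T.
Proof. by move=> ST; apply/val_inj/funext. Qed.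

Lemma add_opE (S T : bounded_op V W) x : (S + T) x = S x + T x.
Proof. by []. Qed.
Lemma scale_opE a (T : bounded_op V W) x : (a *: T) x = a *: T x.
Proof. by []. Qed.
Lemma opp_opE (T : bounded_op V W) x : (- T) x = - T x.
Proof. by rewrite -scaleN1r scale_opE scaleN1r. Qed.
Lemma sub_opE (S T : bounded_op V W) x : (S - T) x = S x - T x.
Proof. by rewrite add_opE opp_opE. Qed.
Lemma zero_opE x : (0 : bounded_op V W) x = 0.
Proof. by []. Qed.
Lemma sum_opE (I : Type) (r : seq I) (F : I -> bounded_op V W) x :
  (\sum_(i <- r) F i) x = \sum_(i <- r) F i x.
Proof.
elim: r => [|i r IH]; first by rewrite !big_nil zero_opE.
by rewrite !big_cons add_opE IH.
Qed.

End Operators.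
End RealNorm.

(** * Ultralimits of bounded sequences *)

Lemma normc_le_ReIm (R : realType) (z : R[i]) :
  complex.Re `|z| <= `|complex.Re z| + `|complex.Im z|.
Proof.
rewrite normc_def /= -(@ler_pXn2r _ 2) ?nnegrE ?sqrtr_ge0 ?addr_ge0//.
rewrite sqr_sqrtr ?addr_ge0 ?sqr_ge0// sqrrD !real_normK ?num_real//.
by rewrite lerD2r lerDl mulrn_wge0// mulr_ge0.
Qed.

Section UltraLimits.
Context (R : realType) (s : scalars).
Local Notation K := (scalar_field R s).
Local Notation "r %:S" := (of_real s r) (at level 2, format "r %:S").
Variables (I : Type) (U : set_system I).
Hypothesis UU : UltraFilter U.

(** The limit is the supremum of the [t] such that [t <= a k] for [U]-almost all
    [k]: an ultrafilter contains each such set or its complement. *)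
Lemma ultra_bounded_real (C : R) (a : I -> R) : (forall k, `|a k| <= C) ->
  exists l : R, forall e, 0 < e -> \forall k \near U, `|l - a k| < e.
Proof.
move=> aC; pose E := [set t : R | U [set k | t <= a k]].
have EN : E (- C).
  by apply: filterE => k /=; have := aC k; rewrite ler_norml => /andP[].
have Eub : ubound E C.
  move=> t /= /filter_ex[k tk]; apply: le_trans tk _.
  by have := aC k; rewrite ler_norml => /andP[].
have Esup : has_sup E by split; [exists (- C)|exists C].
exists (sup E) => e e0.
have [t Et st] := sup_adherent e0 Esup.
have NE : U (~` [set k | sup E + e <= a k]).
  have [UE|//] := in_ultra_setVsetC [set k | sup E + e <= a k] UU.
  have : sup E + e <= sup E by apply: ub_le_sup => //; exists C.
  by rewrite gerDl leNgt e0.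
apply: filterS2 Et NE => k /= tk /negP; rewrite -ltNge => ake.
by rewrite ltr_norml; apply/andP; split; lra.
Qed.

Lemma ultra_bounded_scalar (C : R) (a : I -> K) :
  (forall k, rnorm (a k : K^o) <= C) ->
  exists l : K, (a : I -> K^o) @ U --> (l : K^o).
Proof.
move=> aC; have FU := @ultra_proper _ _ UU.
case: s a aC => /= a aC.
  have [l lP] := ultra_bounded_real aC.
  by exists l; apply/(@cvg_rnormP _ RealScalars) => e e0; exact: lP.
have i1 : `|'i%C : R[i]| = 1 by rewrite normc_def /= expr0n expr1n add0r sqrtr1.
have ReC k : `|complex.Re (a k)| <= C.
  by apply: le_trans (aC k); have := normc_ge_Re (a k); rewrite lecE => /andP[].
have ImC k : `|complex.Im (a k)| <= C.
  apply: le_trans (aC k); have := normc_ge_Re ((a k : R[i]) * 'i%C).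
  by rewrite normrM i1 mulr1 lecE => /andP[_]; case: (a k) => p q; simpc; rewrite /= ?normrN.
have [x xP] := ultra_bounded_real ReC; have [y yP] := ultra_bounded_real ImC.
exists (Complex x y); apply/(@cvg_rnormP _ ComplexScalars) => e e0.
have e20 : 0 < e / 2 by rewrite divr_gt0.
apply: filterS2 (xP _ e20) (yP _ e20) => k xk yk.
apply: le_lt_trans (normc_le_ReIm _) _.
by case: (a k) xk yk => p q /=; lra.
Qed.

End UltraLimits.

Lemma ultra_oo : exists2 U : set_system nat, UltraFilter U & \oo `<=` U.
Proof. by have [U [UU ooU]] := @ultraFilterLemma nat \oo _; exists U. Qed.

Section FiniteDimension.
Context (R : realType) (s : scalars).
Local Notation K := (scalar_field R s).
Local Notation "r %:S" := (of_real s r) (at level 2, format "r %:S").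
Variable V : normedModType K.

Definition ultra_compact (M : set V) :=
  forall (U : set_system nat), UltraFilter U ->
  forall (z : nat -> V) (C : R), (forall k, M (z k)) ->
  (forall k, rnorm (z k) <= C) -> exists2 z0, M z0 & z @ U --> z0.

Fixpoint lin_span (e : seq V) : set V :=
  if e is v :: e' then
    [set x | exists a w, lin_span e' w /\ x = a *: v + w]
  else [set 0].

Lemma lin_span0 e : lin_span e 0.
Proof. by elim: e => //= v e IH; exists 0, 0; rewrite scale0r addr0. Qed.

Lemma lin_spanZD e a x y : lin_span e x -> lin_span e y -> lin_span e (a *: x + y).
Proof.
elim: e x y => [|v e IH] x y /=; first by move=> -> ->; rewrite scaler0 addr0.
move=> [b [w [ew ->]]] [c [t [et ->]]].
exists (a * b + c), (a *: w + t); split; first exact: IH.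
by rewrite scalerDr scalerDl scalerA addrACA.
Qed.

Lemma lin_spanZ e a x : lin_span e x -> lin_span e (a *: x).
Proof. by move=> ex; rewrite -[_ *: _]addr0; apply: lin_spanZD => //; exact: lin_span0. Qed.

Lemma lin_span_sum (J : Type) (l : seq J) (c : J -> K) (e : J -> V) :
  lin_span (map e l) (\sum_(i <- l) c i *: e i).
Proof.
elim: l => [|i l IH] /=; first by rewrite big_nil.
by exists (c i), (\sum_(i <- l) c i *: e i); rewrite big_cons.
Qed.

(** A vector outside an ultra-compact subspace lies at positive distance from
    it: a minimising sequence is bounded, so it has an ultralimit in the
    subspace, and that limit would be the vector itself. *)
Lemma ultra_compact_dist e v : ultra_compact (lin_span e) -> ~ lin_span e v ->
  exists2 d : R, 0 < d & forall w, lin_span e w -> d <= rnorm (v + w).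
Proof.
move=> ce nev; apply: contrapT => H.
have sel (n : nat) : exists w, lin_span e w /\ rnorm (v + w) < n.+1%:R^-1.
  apply: contrapT => Hn; apply: H; exists n.+1%:R^-1 => // w ew.
  by rewrite leNgt; apply/negP => vw; apply: Hn; exists w.
have /choice[w wP] := sel.
have [U UU ooU] := ultra_oo; have FU := @ultra_proper _ _ UU.
have wC k : rnorm (w k) <= 1 + rnorm v.
  have -> : w k = (v + w k) - v by rewrite addrAC subrr add0r.
  rewrite (le_trans (ler_rnormB _ _))// lerD2r.
  apply: (le_trans (ltW (wP k).2)).
  by rewrite invf_le1// ler1n.
have [z ez wz] := ce U UU w _ (fun k => (wP k).1) wC.
apply: nev; suff -> : v = (-1) *: z by exact: lin_spanZ.
apply/eqP; rewrite scaleN1r -addr_eq0 -rnorm_eq0 eq_le rnorm_ge0 andbT.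
apply/ler_addgt0Pr => eps eps0; rewrite add0r.
have e20 : 0 < eps / 2 by rewrite divr_gt0.
have ooe : \forall k \near \oo, (k.+1%:R^-1 : R) < eps / 2.
  by exact: near_infty_natSinv_lt (PosNum e20).
have [k [/= zk ke]] := filter_ex (filterI ((cvg_rnormP _ _).1 wz _ e20) (ooU _ ooe)).
have -> : v + z = (v + w k) + (z - w k) by rewrite addrACA subrr addr0.
rewrite (le_trans (ler_rnormD _ _))//.
by rewrite [leRHS]splitr lerD ?(ltW zk)// ltW// (lt_trans (wP k).2).
Qed.

(** Bounded sequences in a finite-dimensional subspace converge along every
    ultrafilter, by induction on a spanning family: the coefficient on a new
    independent vector is bounded by its distance to the previous span. *)
Lemma lin_span_ultra_compact e : ultra_compact (lin_span e).
Proof.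
elim: e => [|v e IH] U UU z C ez zC; have FU := @ultra_proper _ _ UU.
  exists 0 => //; apply/cvg_rnormP => eps eps0; apply: filterE => k.
  by rewrite (ez k) subrr rnorm0.
have [ev|nev] := pselect (lin_span e v).
  have ez' k : lin_span e (z k).
    by have [a [w [ew ->]]] := ez k; exact: lin_spanZD.
  have [z0 ez0 zz0] := IH U UU z C ez' zC; exists z0 => //=.
  by exists 0, z0; rewrite scale0r add0r.
have [d d0 dP] := ultra_compact_dist IH nev.
have /choice[a /choice[w awP]] := ez.
have aC k : rnorm (a k : K^o) <= C / d.
  have [-> |ak0] := eqVneq (a k) 0.
    by rewrite rnorm0 divr_ge0 ?(ltW d0)// (le_trans (rnorm_ge0 (z k))).
  rewrite ler_pdivlMr//; apply: le_trans (zC k).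
  have -> : z k = a k *: (v + (a k)^-1 *: w k).
    by rewrite scalerDr scalerA mulfV// scale1r; exact: (awP k).2.
  rewrite rnormZ ler_wpM2l ?re_ge0//; apply: dP.
  by apply: lin_spanZ; exact: (awP k).1.
have [l al] := ultra_bounded_scalar UU aC.
have avl : (fun k => a k *: v) @ U --> l *: v by apply: cvgZr_tmp.
have wC k : rnorm (w k) <= C + C / d * rnorm v.
  have -> : w k = z k - a k *: v by rewrite (awP k).2 addrAC subrr add0r.
  rewrite (le_trans (ler_rnormB _ _))// lerD// rnormZ ler_wpM2r ?rnorm_ge0//.
  exact: aC.
have [w0 ew0 ww0] := IH U UU w _ (fun k => (awP k).1) wC.
exists (l *: v + w0); first by exists l, w0.
have -> : z = (fun k => a k *: v) \+ w by apply/funext => k; exact: (awP k).2.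
exact: cvgD.
Qed.

Lemma finite_dim_ultra_compact (M : set V) (U : set_system nat) :
  UltraFilter U -> finite_dim_subspace M ->
  forall (z : nat -> V) (C : R), (forall k, M (z k)) ->
  (forall k, rnorm (z k) <= C) -> exists z0 : V, z @ U --> z0.
Proof.
move=> UU [d [e ->]] z C Mz zC.
have ez k : lin_span (map e (index_enum 'I_d)) (z k).
  by have [c _ <-] := Mz k; exact: lin_span_sum.
by have [z0 _ zz0] := lin_span_ultra_compact UU ez zC; exists z0.
Qed.

End FiniteDimension.

(** * The Hahn-Banach theorem *)

Section HahnBanach.
Context (R : realType) (s : scalars).
Local Notation K := (scalar_field R s).
Local Notation "r %:S" := (of_real s r) (at level 2, format "r %:S").
Variables (V : lmodType K) (p : V -> R -> Prop).

(** [p v a] stands for the inequality [q v <= a], where [q] is a sublinear gauge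
    that may be infinite.  The nuclear norm is handled in this form, since it is
    finite on nuclear operators only. *)
Record sublinear_epigraph : Prop := {
  epi0 : p 0 0;
  epi_ge0 : forall v a, p v a -> 0 <= a;
  epi_mono : forall v a b, p v a -> a <= b -> p v b;
  epiD : forall v w a b, p v a -> p w b -> p (v + w) (a + b);
  epiZ : forall v a t, 0 <= t -> p v a -> p (t%:S *: v) (t * a);
  epiN : forall v a, p v a -> p (- v) a }.

Definition epi_dom (v : V) := exists a, p v a.

Hypothesis pE : sublinear_epigraph.
Variables (v0 : V) (p0 : R).
Hypothesis p0_lb : forall a, p v0 a -> p0 <= a.

Definition convex_cone (C : set (V * R)) :=
  (forall v w a b, C (v, a) -> C (w, b) -> C (v + w, a + b)) /\
  (forall v a t, 0 <= t -> C (v, a) -> C (t%:S *: v, t * a)).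

Definition proper_cone C := convex_cone C /\ ~ C (0, -1).

(** The cone generated by the epigraph and [(- v0, - p0)]; the second generator
    forces [p0 <= u v0]. *)
Let B : set (V * R) :=
  [set x | exists2 t, 0 <= t & p (x.1 + t%:S *: v0) (x.2 + t * p0)].

Let pB v a : p v a -> B (v, a).
Proof. by move=> pva; exists 0 => //=; rewrite of_real0 scale0r mul0r !addr0. Qed.

Let B_proper : proper_cone B.
Proof.
split; [split=> [v w a b [t t0 /= pt] [u u0 /= pu]|v a t t0 [u u0 /= pu]]|].
- exists (t + u); first exact: addr_ge0.
  by rewrite /= of_realD scalerDl mulrDl (addrACA v) (addrACA a); exact: (epiD pE).
- exists (t * u); first exact: mulr_ge0.
  by rewrite /= of_realM -scalerA -scalerDr -mulrA -mulrDr; exact: (epiZ pE).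
- move=> [t t0 /=]; rewrite add0r => pt.
  have [t00|tn0] := eqVneq t 0.
    by have := epi_ge0 pE pt; rewrite t00 mul0r addr0 oppr_ge0 ler10.
  have tV0 : 0 <= t^-1 by rewrite invr_ge0.
  have := epiZ pE tV0 pt.
  rewrite scalerA -of_realM mulVf// of_real1 scale1r => /p0_lb.
  rewrite mulrDr mulrA mulVf// mul1r mulrN1 lerDr oppr_ge0 invr_le0.
  by rewrite le_eqVlt (negbTE tn0)/= ltNge t0.
Qed.

(** If neither [x] nor [- x] lies in a maximal cone [C], then the larger cone
    generated by [C] and [x] contains [(0, -1) = c + t x] with [c] in [C] and
    [0 < t], so that [- x = t^-1 (c + (0, 1))] lies in [C].  Zorn's lemma is
    applied to the sets [X] such that [B `|` X] is a proper cone, because the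
    union of the empty chain is empty. *)
Let maximal_cone : exists C, [/\ proper_cone C, B `<=` C &
  forall v a, C (v, a) \/ C (- v, - a)].
Proof.
have [F FP Ftot|A [[[AD AZ] A1] Amax]] :=
    @Zorn_bigcup _ (fun X => proper_cone (B `|` X)).
  have [[X0 FX0]|F0] := pselect (exists X, F X); last first.
    suff -> : \bigcup_(X in F) X = set0 by rewrite setU0; exact: B_proper.
    by rewrite -subset0 => x [X FX _]; case: F0; exists X.
  have lift x : (B `|` \bigcup_(X in F) X) x -> exists2 X, F X & (B `|` X) x.
    by move=> [Bx|[X FX Xx]]; [exists X0 => //; left|exists X => //; right].
  have back X x : F X -> (B `|` X) x -> (B `|` \bigcup_(X in F) X) x.
    by move=> FX [Bx|Xx]; [left|right; exists X].
  split; [split=> [v w a b /lift[X FX Xv] /lift[Y FY Yw]|v a t t0 /lift[X FX Xv]]|].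
  - have [XY|YX] := Ftot _ _ FX FY.
      apply: (back Y) => //; apply: (FP _ FY).1.1 => //.
      by case: Xv => [|/XY]; [left|right].
    apply: (back X) => //; apply: (FP _ FX).1.1 => //.
    by case: Yw => [|/YX]; [left|right].
  - by apply: (back X) => //; exact: (FP _ FX).1.2.
  - by move=> /lift[X FX]; exact: (FP _ FX).2.
exists (B `|` A); split=> // v a.
apply: contrapT => /not_orP[nC nCN].
pose C' := [set x : V * R | exists w b t,
  [/\ (B `|` A) (w, b), 0 <= t & x = (w + t%:S *: v, b + t * a)]].
have BAC' : B `|` A `<=` C'.
  move=> [w b] BAw; exists w, b, 0; split=> //.
  by rewrite of_real0 scale0r mul0r !addr0.
have A_C' : A `<` C'.
  split=> [x Ax|C'A]; first by apply: BAC'; right.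
  apply: nC; right; apply: C'A; exists 0, 0, 1; split=> //.
    by left; apply: pB; exact: epi0 pE.
  by rewrite of_real1 scale1r mul1r !add0r.
apply: (Amax C') => //; rewrite (_ : B `|` C' = C'); last first.
  by apply/setUidPr => x Bx; apply: BAC'; left.
split; [split|].
- move=> w1 w2 b1 b2 [x1 [c1 [t1 [C1 t10 [-> ->]]]]] [x2 [c2 [t2 [C2 t20 [-> ->]]]]].
  exists (x1 + x2), (c1 + c2), (t1 + t2); split; [exact: AD|exact: addr_ge0|].
  by rewrite of_realD scalerDl mulrDl (addrACA x1) (addrACA c1).
- move=> w b t t0 [x [c [u [Cx u0 [-> ->]]]]].
  exists (t%:S *: x), (t * c), (t * u); split; [exact: AZ|exact: mulr_ge0|].
  by rewrite scalerDr scalerA -of_realM mulrDr mulrA.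
- move=> [w [b [t [Cw t0 [e1 e2]]]]].
  have [t00|tn0] := eqVneq t 0.
    apply: A1; move: Cw e1 e2.
    by rewrite t00 of_real0 scale0r mul0r !addr0 => ? -> ->.
  apply: nCN.
  have C01 : (B `|` A) (0, 1).
    by left; apply: pB; apply: (epi_mono pE (epi0 pE)).
  have tV0 : 0 <= t^-1 by rewrite invr_ge0.
  have := AZ _ _ _ tV0 (AD _ _ _ _ Cw C01).
  have -> : w + 0 = - (t%:S *: v) by apply/eqP; rewrite addr0 -addr_eq0 -e1.
  have -> : b + 1 = - (t * a) by apply/eqP; rewrite -addr_eq0 addrAC -e2 addNr.
  by rewrite scalerN scalerA -of_realM mulrN mulrA mulVf// of_real1 scale1r mul1r.
Qed.

(** The Hahn-Banach theorem for a sublinear gauge [p] given by its epigraph and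
    finite only on [epi_dom].  The cone generated by the epigraph and
    [(- v0, - p0)] does not contain [(0, -1)]; a maximal convex cone with this
    property contains [x] or [- x] for every [x], so it is the epigraph of a
    linear functional. *)
Lemma hahn_banach : exists u : V -> R,
  [/\ forall v w, epi_dom v -> epi_dom w -> u (v + w) = u v + u w,
      forall v t, epi_dom v -> u (t%:S *: v) = t * u v,
      forall v a, p v a -> u v <= a
    & epi_dom v0 -> p0 <= u v0].
Proof.
have [C [[[CD CZ] C1] BC Ctot]] := maximal_cone.
have C0 a : C (0, a) -> 0 <= a.
  move=> Ca; rewrite leNgt; apply/negP => a0; apply: C1.
  have t0 : 0 <= - a^-1 by rewrite oppr_ge0 invr_le0 ltW.
  by have := CZ _ _ _ t0 Ca; rewrite scaler0 mulNr mulVf// lt_eqF.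
have Cp a : 0 <= a -> C (0, a).
  by move=> a0; apply/BC/pB; exact: (epi_mono pE (epi0 pE) a0).
have Cmono v a b : C (v, a) -> a <= b -> C (v, b).
  move=> Ca ab; have := CD _ _ _ _ Ca (Cp (b - a) _).
  by rewrite addr0 [a + _]addrC subrK; apply; rewrite subr_ge0.
(* [C] is the epigraph of [u]: above [u v] lie the points of [C], below it the
   opposites of points of [C]. *)
pose u v := inf [set a | C (v, a)].
have hinf v : epi_dom v -> has_inf [set a | C (v, a)].
  move=> [a pa]; split; first by exists a; exact/BC/pB.
  exists (- a) => b /= Cb; rewrite -subr_ge0 opprK; apply: C0.
  by rewrite -[0](subrr v); apply: CD => //; apply/BC/pB/(epiN pE).
have u_le v a : epi_dom v -> C (v, a) -> u v <= a.
  by move=> /hinf[_ lbv] Ca; exact: ge_inf.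
have u_ge v a : epi_dom v -> C (- v, - a) -> a <= u v.
  move=> /hinf[nv _] Ca; apply: lb_le_inf => // b Cb.
  by rewrite -subr_ge0; apply: C0; rewrite -[0](subrr v); exact: CD.
have Cup v e : epi_dom v -> 0 < e -> C (v, u v + e).
  move=> /hinf hv e0; have [a Ca au] := inf_adherent e0 hv.
  exact: Cmono Ca (ltW au).
have Cdn v e : epi_dom v -> 0 < e -> C (- v, - (u v - e)).
  move=> dv e0; have [/(u_le _ _ dv)|//] := Ctot v (u v - e).
  by rewrite lerBrDr gerDl leNgt e0.
have domD v w : epi_dom v -> epi_dom w -> epi_dom (v + w).
  by move=> [a pa] [b pb]; exists (a + b); exact: (epiD pE).
have domN v : epi_dom v -> epi_dom (- v) by move=> [a pa]; exists a; exact: (epiN pE).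
have uD v w : epi_dom v -> epi_dom w -> u (v + w) = u v + u w.
  move=> dv dw; have dvw := domD _ _ dv dw.
  apply/eqP; rewrite eq_le; apply/andP; split; apply/ler_addgt0Pr => e e0.
    have e20 : 0 < e / 2 by rewrite divr_gt0.
    apply: u_le => //; have := CD _ _ _ _ (Cup v _ dv e20) (Cup w _ dw e20).
    by rewrite addrACA -splitr.
  rewrite -lerBlDr; apply: u_ge => //.
  have e20 : 0 < e / 2 by rewrite divr_gt0.
  have -> : u v + u w - e = (u v - e / 2) + (u w - e / 2).
    by lra.
  by rewrite opprD [in X in (_, X)]opprD; apply: CD; exact: Cdn.
have u0 : u 0 = 0.
  have d0 : epi_dom 0 by exists 0; exact: epi0 pE.
  by have := uD _ _ d0 d0; rewrite addr0 => /eqP; rewrite -subr_eq subrr eq_sym => /eqP.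
have uN v : epi_dom v -> u (- v) = - u v.
  move=> dv; apply/eqP; rewrite -addr_eq0 addrC -uD//; last exact: domN.
  by rewrite subrr u0.
have uZ v t : 0 <= t -> epi_dom v -> u (t%:S *: v) = t * u v.
  move=> t0 dv.
  have dtv : epi_dom (t%:S *: v).
    by have [a pa] := dv; exists (t * a); exact: (epiZ pE).
  have t10 : 0 < t + 1 by rewrite ltr_wpDl.
  have te e : 0 < e -> 0 < e / (t + 1) /\ t * (e / (t + 1)) <= e.
    move=> e0; split; first by rewrite divr_gt0.
    rewrite mulrCA ger_pMr// ler_pdivrMr// mul1r lerDl//.
  apply/eqP; rewrite eq_le; apply/andP; split; apply/ler_addgt0Pr => e /te[d0 de].
    apply: (@le_trans _ _ (t * (u v + e / (t + 1)))); last by rewrite mulrDr lerD2l.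
    by apply: u_le => //; apply: CZ => //; exact: Cup.
  apply: (@le_trans _ _ (t * (u v - e / (t + 1)) + e)).
    by rewrite mulrBr -addrA lerDl addrC subr_ge0.
  rewrite lerD2r; apply: u_ge => //; rewrite -scalerN -mulrN.
  by apply: CZ => //; exact: Cdn.
exists u; split=> // [v t dv|v a pa|d0].
- have [t0|t0] := leP 0 t; first exact: uZ.
  rewrite -[t]opprK of_realN scaleNr uN ?uZ ?mulNr ?oppr_ge0 ?(ltW t0)//.
  by have [a pa] := dv; exists (- t * a); apply: (epiZ pE) => //; rewrite oppr_ge0 ltW.
- by apply: u_le; [exists a|exact/BC/pB].
- apply: u_ge => //; apply: BC; exists 1 => //=.
  by rewrite of_real1 scale1r mul1r !addNr; exact: epi0 pE.
Qed.

End HahnBanach.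

(** * Norming functionals *)

Section Functionals.
Context (R : realType).
Local Notation "r %:S" := (of_real _ r) (at level 2, format "r %:S").

(** Over the complex numbers [g v = u v - i u (i v)].  The bound 2 is cruder than
    the sharp 1, but any constant serves to estimate a limit. *)
Lemma complexify (s : scalars) (V : normedModType (scalar_field R s)) (u : V -> R) :
  (forall v w, u (v + w) = u v + u w) ->
  (forall v (t : R), u (t%:S *: v) = t * u v) ->
  (forall v, u v <= rnorm v) ->
  exists g : dual V, [/\ rnorm g <= 2 & forall v, `|u v| <= rnorm (g v : (scalar_field R s)^o)].
Proof.
move=> uD uZ u1.
have uabs v : `|u v| <= rnorm v.
  rewrite ler_norml lerNl u1 andbT -rnormN.
  have -> : - u v = u (- v) by rewrite -[- v]scaleN1r -of_real1 -of_realN uZ mulN1r.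
  exact: u1.
suff [g [lg g2 gu]] : exists g : V -> (scalar_field R s)^o, [/\ linear g,
    forall v, rnorm (g v) <= 2 * rnorm v & forall v, `|u v| <= rnorm (g v)].
  exists (mk_op lg g2); split; last exact: gu.
  by apply: rnorm_op_le.
case: s V u uD uZ u1 uabs => V u uD uZ u1 uabs.
  exists (u : V -> (scalar_field R RealScalars)^o); split=> //.
    by move=> a v w; rewrite uD; congr (_ + _); exact: uZ.
  move=> v; rewrite (le_trans (uabs v))// ler_peMl ?rnorm_ge0//.
  by rewrite ler1n.
pose i : scalar_field R ComplexScalars := 'i%C.
pose g v : (scalar_field R ComplexScalars)^o := Complex (u v) (- u (i *: v)).
exists g; split.
- move=> a v w.
  pose x : scalar_field R ComplexScalars := of_real _ (complex.Re a).
  pose y : scalar_field R ComplexScalars := of_real _ (complex.Im a).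
  have aE : a = x + y * i by rewrite /x /y /i; clear; case: a => a b /=; simpc.
  have iaE : i * a = x * i - y by rewrite /x /y /i; clear; case: a => a b /=; simpc.
  rewrite /g scalerDr scalerA iaE {1}aE !uD !scalerDl !uD.
  rewrite -!scalerA /y -of_realN !uZ.
  rewrite -[RHS]/(a * g v + g w) /g; by case: (a) => p q /=; simpc.

- move=> v; apply: (le_trans (normc_le_ReIm (g v))).
  rewrite /= normrN mulr_natl mulr2n lerD// (le_trans (uabs _))//.
  rewrite rnormZ (_ : re _ = 1) ?mul1r//.
  by rewrite /re /i normc_def /= expr0n expr1n add0r sqrtr1.
- by move=> v; have := normc_ge_Re (g v); rewrite lecE => /andP[].
Qed.

Variable s : scalars.
Local Notation K := (scalar_field R s).

Lemma norming_functional (V : normedModType K) (w : V) :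
  exists g : dual V, rnorm g <= 2 /\ rnorm w <= rnorm (g w : K^o).
Proof.
have pE : sublinear_epigraph (fun (v : V) a => rnorm v <= a).
  split=> [|v a|v a b|v x a b va xb|v a t t0 va|v a].
  - by rewrite rnorm0.
  - exact: le_trans (rnorm_ge0 _).
  - exact: le_trans.
  - by rewrite (le_trans (ler_rnormD _ _))// lerD.
  - by rewrite rnormZr ger0_norm// ler_wpM2l.
  - by rewrite rnormN.
have dom v : epi_dom (fun (v : V) a => rnorm v <= a) v by exists (rnorm v).
have [u [uD uZ u1 uw]] := hahn_banach (v0 := w) (p0 := rnorm w) pE (fun a => id).
have [g [g2 gu]] := complexify (fun v w => uD v w (dom v) (dom w))
  (fun v t => uZ v t (dom v)) (fun v => u1 v _ (lexx _)).
exists g; split=> //; apply: le_trans (gu w).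
by rewrite (le_trans (uw (dom w)))// ler_norm.
Qed.

End Functionals.

(** * The nuclear norm *)

Section NuclearCalculus.
Context (R : realType) (s : scalars).
Local Notation K := (scalar_field R s).
Local Notation "r %:S" := (of_real s r) (at level 2, format "r %:S").
Variables X Y : normedModType K.

Section Tensor.
Variables (f : dual X) (y : Y).

Let tensor_linear : linear (fun x : X => (f x : K) *: y).
Proof. by move=> a v w; rewrite linearP scalerDl -scalerA. Qed.

Let tensor_bound x : rnorm ((f x : K) *: y) <= rnorm f * rnorm y * rnorm x.
Proof.
by rewrite rnormZ mulrAC ler_wpM2r ?rnorm_ge0//; exact: rnorm_op.
Qed.

Definition tensor : bounded_op X Y := mk_op tensor_linear tensor_bound.

Lemma tensorE x : tensor x = (f x : K) *: y.
Proof. by []. Qed.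

End Tensor.

Lemma tensorDl f g y : tensor (f + g) y = tensor f y + tensor g y.
Proof. by apply: bounded_op_ext => x; rewrite add_opE !tensorE scalerDl. Qed.

Lemma tensorDr f y z : tensor f (y + z) = tensor f y + tensor f z.
Proof. by apply: bounded_op_ext => x; rewrite add_opE !tensorE scalerDr. Qed.

Lemma tensorZl a f y : tensor (a *: f) y = a *: tensor f y.
Proof. by apply: bounded_op_ext => x; rewrite scale_opE !tensorE scalerA. Qed.

Lemma tensorZr a f y : tensor f (a *: y) = a *: tensor f y.
Proof.
by apply: bounded_op_ext => x; rewrite scale_opE !tensorE !scalerA mulrC.
Qed.

Lemma tensorBl f g y : tensor (f - g) y = tensor f y - tensor g y.
Proof. by rewrite -scaleN1r tensorDl tensorZl scaleN1r. Qed.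

Lemma tensorBr f y z : tensor f (y - z) = tensor f y - tensor f z.
Proof. by rewrite -scaleN1r tensorDr tensorZr scaleN1r. Qed.

Implicit Types (T S : bounded_op X Y) (f : nat -> dual X) (y : nat -> Y).

Lemma representation_sum_leP f y (r : R) :
  (representation_sum f y <= r%:E)%E <->
  forall n, \sum_(k < n) rnorm (f k) * rnorm (y k) <= r.
Proof.
have ge0 k : (0 <= (re (`|f k| * `|y k|))%:E)%E.
  by rewrite lee_fin re_mul_norm mulr_ge0 ?rnorm_ge0.
have psE n : (\sum_(0 <= k < n) (re (`|f k| * `|y k|))%:E)%E =
    (\sum_(k < n) rnorm (f k) * rnorm (y k))%:E.
  by rewrite sumEFin big_mkord; congr EFin; apply: eq_bigr => k _; rewrite re_mul_norm.
split=> [fr n|fr].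
  rewrite -lee_fin -psE; apply: le_trans fr.
  by apply: nneseries_lim_ge => k _ _; exact: ge0.
apply: lime_le; first by apply: is_cvg_nneseries => k _ _; exact: ge0.
by apply: nearW => n; rewrite psE lee_fin.
Qed.

Definition represents T f y (r : R) :=
  nuclear_representation T f y /\ (representation_sum f y <= r%:E)%E.

Lemma bounded_rnormP (V : normedModType K) (z : nat -> V) :
  bounded_fun z <-> exists C, forall k, rnorm (z k) <= C.
Proof.
split=> [/pinfty_ex_gt0[C C0 zC]|[C zC]].
  exists (re C) => k; rewrite -(of_real_le s) -rnormE reK ?(ltW C0)//.
  exact: zC.
exists C%:S; split.
  by rewrite ger0_real// of_real_ge0; exact: le_trans (rnorm_ge0 _) (zC 0).
move=> M CM k _ /=; rewrite rnormE; apply: le_trans (ltW CM).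
by rewrite of_real_le.
Qed.

Lemma representsP T f y r :
  represents T f y r <->
  [/\ exists C, forall k, rnorm (f k) <= C,
      exists C, forall k, rnorm (y k) <= C,
      forall n, \sum_(k < n) rnorm (f k) * rnorm (y k) <= r
    & forall x, (fun n => \sum_(k < n) (f k x : K) *: y k) @ \oo --> T x].
Proof.
have serE x : series (fun n => (f n x : K) *: y n) = fun n => \sum_(k < n) (f k x : K) *: y k.
  by apply/funext => n; rewrite seriesEord.
split=> [[[/bounded_rnormP bf /bounded_rnormP by_ _ Tfy] /representation_sum_leP fr]|].
  by split=> // x; rewrite -serE.
move=> [/bounded_rnormP bf /bounded_rnormP by_ /representation_sum_leP fr Tfy].
split=> //; split=> // [|x]; last by rewrite serE.
by apply: le_lt_trans fr _; exact: ltry.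
Qed.

(** The epigraph of the nuclear norm, up to its boundary: the infimum of these
    [r] is [nuclear_norm T], and there is none if [T] is not nuclear. *)
Definition nuclear_le T r := exists f y, represents T f y r.

Lemma representation_sum_ge0 f y : (0 <= representation_sum f y)%E.
Proof.
by apply: nneseries_ge0 => k _ _; rewrite lee_fin re_mul_norm mulr_ge0 ?rnorm_ge0.
Qed.

Lemma nuclearP T : nuclear T <-> exists r, nuclear_le T r.
Proof.
split=> [[f [y Tfy]]|[r [f [y [Tfy _]]]]]; last by exists f, y.
exists (fine (representation_sum f y)), f, y; split=> //.
rewrite fineK// ge0_fin_numE ?representation_sum_ge0//.
by case: Tfy.
Qed.

Lemma nuclear_norm_leP T r : nuclear_le T r -> (nuclear_norm T <= r%:E)%E.
Proof.
move=> [f [y [Tfy fr]]]; apply: le_trans fr.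
by apply: ereal_inf_lbound; exists f, y.
Qed.

Lemma nuclear_le_ge0 T r : nuclear_le T r -> 0 <= r.
Proof. by move=> [f [y /representsP[_ _ /(_ 0)]]]; rewrite big_ord0. Qed.

Lemma nuclear_le_mono T a b : nuclear_le T a -> a <= b -> nuclear_le T b.
Proof.
move=> [f [y [Tfy fa]]] ab; exists f, y; split=> //.
by rewrite (le_trans fa)// lee_fin.
Qed.

Lemma represents_finite n (f : nat -> dual X) (y : nat -> Y) :
  (forall k, (n <= k)%N -> f k = 0 /\ y k = 0) ->
  represents (\sum_(k < n) tensor (f k) (y k)) f y
    (\sum_(k < n) rnorm (f k) * rnorm (y k)).
Proof.
move=> fy0.
have bnd (V : normedModType K) (z : nat -> V) : (forall k, (n <= k)%N -> z k = 0) ->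
    exists C, forall k, rnorm (z k) <= C.
  move=> z0; exists (\sum_(k < n) rnorm (z k)) => k.
  have [/z0->|kn] := leqP n k; first by rewrite rnorm0 sumr_ge0// => *; exact: rnorm_ge0.
  by rewrite (bigD1 (Ordinal kn))//= lerDl sumr_ge0// => *; exact: rnorm_ge0.
have tail (G : zmodType) (F : nat -> G) m : (n <= m)%N -> (forall k, (n <= k)%N -> F k = 0) ->
    \sum_(k < m) F k = \sum_(k < n) F k.
  move=> nm F0; rewrite -!(big_mkord xpredT F) (big_cat_nat (n := n))//=.
  by rewrite [X in _ + X]big_nat [X in _ + X]big1 ?addr0// => k /andP[/F0].
apply/representsP; split.
- by apply: bnd => k /fy0[].
- by apply: bnd => k /fy0[].
- move=> m; have [nm|mn] := leqP n m.
    rewrite (tail R (fun k => rnorm (f k) * rnorm (y k)) m nm)// => k /fy0[-> _].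
    by rewrite rnorm0 mul0r.
  rewrite -!(big_mkord xpredT (fun k => rnorm (f k) * rnorm (y k))).
  rewrite [leRHS](big_cat_nat (n := m)) ?(ltnW mn)//= lerDl sumr_ge0// => k _.
  by rewrite mulr_ge0 ?rnorm_ge0.
- move=> x; rewrite sum_opE.
  apply: (@cvg_near_cst _ _ _ _ _ _); exists n => // m /= nm.
  rewrite (tail Y (fun k => (f k x : K) *: y k) m nm)// => k /fy0[-> _].
  by rewrite zero_opE scale0r.
Qed.

Lemma nuclear_le0 : nuclear_le 0 0.
Proof.
exists (fun=> 0), (fun=> 0); have := @represents_finite 0 (fun=> 0) (fun=> 0).
by rewrite !big_ord0; apply.
Qed.

Lemma nuclear_le_tensor (f : dual X) (y : Y) : nuclear_le (tensor f y) (rnorm f * rnorm y).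
Proof.
exists (fun k => if k is 0 then f else 0), (fun k => if k is 0 then y else 0).
have := @represents_finite 1 (fun k => if k is 0 then f else 0) (fun k => if k is 0 then y else 0).
by rewrite !big_ord1; apply; case.
Qed.

Lemma nuclear_leZ a T r : nuclear_le T r -> nuclear_le (a *: T) (re `|a| * r).
Proof.
move=> [f [y /representsP[[C fC] [D yD] fr Tfy]]].
exists (fun k => a *: f k), y; apply/representsP; split.
- by exists (re `|a| * C) => k; rewrite rnormZ ler_wpM2l ?re_ge0.
- by exists D.
- move=> n; under eq_bigr do rewrite rnormZ -mulrA.
  by rewrite -mulr_sumr ler_wpM2l ?re_ge0.
- move=> x; rewrite scale_opE.
  under eq_cvg do (under eq_bigr do rewrite scale_opE -scalerA; rewrite -scaler_sumr).
  exact: cvgZl_tmp.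
Qed.

(** Interleaving two representations adds their weights. *)
Lemma nuclear_leD S T a b : nuclear_le S a -> nuclear_le T b -> nuclear_le (S + T) (a + b).
Proof.
move=> [f [y /representsP[[C fC] [D yD] fa Sfy]]].
move=> [g [z /representsP[[E gE] [F zF] gb Tgz]]].
pose mix (V : Type) (p q : nat -> V) k := if odd k then q k./2 else p k./2.
have mixE (G : zmodType) (p q : nat -> G) n : \sum_(k < n) mix G p q k =
    \sum_(k < uphalf n) p k + \sum_(k < n./2) q k.
  elim: n => [|n IH]; first by rewrite !big_ord0 addr0.
  rewrite big_ord_recr IH /mix /= uphalf_half.
  case: (odd n); first by rewrite add1n [X in _ = _ + X]big_ord_recr -addrA.
  by rewrite add0n [X in _ = X + _]big_ord_recr addrAC.
have bnd (V : normedModType K) (p q : nat -> V) A B : (forall k, rnorm (p k) <= A) ->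
    (forall k, rnorm (q k) <= B) -> exists M, forall k, rnorm (mix V p q k) <= M.
  move=> pA qB; exists (Num.max A B) => k; rewrite /mix le_max.
  by case: (odd k); rewrite ?pA ?qB ?orbT.
exists (mix _ f g), (mix _ y z); apply/representsP; split.
- exact: bnd fC gE.
- exact: bnd yD zF.
- move=> n; rewrite (eq_bigr (fun k : 'I_n => mix _ (fun k => rnorm (f k) * rnorm (y k))
    (fun k => rnorm (g k) * rnorm (z k)) k)); last first.
    by move=> k _; rewrite /mix; case: odd.
  by rewrite mixE lerD.
- move=> x; rewrite add_opE.
  rewrite (_ : (fun n => _) = (fun n => \sum_(k < uphalf n) (f k x : K) *: y k) \+
     (fun n => \sum_(k < n./2) (g k x : K) *: z k)); last first.
    apply/funext => n /=.
    rewrite -(mixE Y (fun k => (f k x : K) *: y k) (fun k => (g k x : K) *: z k)).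
    by apply: eq_bigr => k _; rewrite /mix; case: odd.
  have half_oo : half @ \oo --> \oo.
    by apply/cvgnyPge => A; exists A.*2 => // n /= An; rewrite -(doubleK A) half_leq.
  have uphalf_oo : uphalf @ \oo --> \oo.
    by apply/cvgnyPge => A; exists A.*2 => // n /= An; rewrite -(uphalf_double A) uphalf_leq.
  apply: cvgD.
  + exact: (cvg_comp _ (fun n => \sum_(k < n) (f k x : K) *: y k) uphalf_oo (Sfy x)).
  + exact: (cvg_comp _ (fun n => \sum_(k < n) (g k x : K) *: z k) half_oo (Tgz x)).
Qed.

Lemma nuclear_leN T r : nuclear_le T r -> nuclear_le (- T) r.
Proof.
move=> Tr; rewrite -scaleN1r -[r]mul1r.
have -> : 1 = re `|- 1 : K| by rewrite -of_real1 -of_realN norm_of_real of_realK normrN1.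
exact: nuclear_leZ.
Qed.

Lemma nuclear_le_sum n (T : 'I_n -> bounded_op X Y) (r : 'I_n -> R) :
  (forall k, nuclear_le (T k) (r k)) -> nuclear_le (\sum_k T k) (\sum_k r k).
Proof.
move=> Tr; elim/big_rec2: _ => [|k a S _ Sa]; first exact: nuclear_le0.
exact: nuclear_leD.
Qed.

Lemma nuclear_epigraph : sublinear_epigraph nuclear_le.
Proof.
split; [exact: nuclear_le0|exact: nuclear_le_ge0|exact: nuclear_le_mono
  |exact: nuclear_leD| |exact: nuclear_leN].
move=> T a t t0 Ta; have := nuclear_leZ t%:S Ta.
by rewrite norm_of_real of_realK ger0_norm.
Qed.

Lemma nuclear_le_remainder T f y r n : represents T f y r ->
  nuclear_le (T - \sum_(k < n) tensor (f k) (y k))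
    (r - \sum_(k < n) rnorm (f k) * rnorm (y k)).
Proof.
move=> /representsP[[C fC] [D yD] fr Tfy].
have split_sum (G : zmodType) (F : nat -> G) m :
    \sum_(k < m) F (n + k)%N = \sum_(k < n + m) F k - \sum_(k < n) F k.
  by rewrite big_split_ord /= addrAC subrr add0r.
exists (fun k => f (n + k)%N), (fun k => y (n + k)%N); apply/representsP; split.
- by exists C.
- by exists D.
- move=> m; rewrite (split_sum _ (fun k => rnorm (f k) * rnorm (y k))).
  by rewrite lerD2r.
- move=> x; rewrite sub_opE sum_opE.
  under eq_cvg do rewrite (split_sum _ (fun k => (f k x : K) *: y k)).
  apply: cvgB; last exact: cvg_cst.
  exact: (cvg_comp _ (fun n => \sum_(k < n) (f k x : K) *: y k) (@cvg_addnl n) (Tfy x)).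
Qed.

Lemma weights_nondecreasing f y : {homo (fun n => \sum_(k < n) rnorm (f k) * rnorm (y k)) :
  m n / (m <= n)%N >-> m <= n}.
Proof.
apply: homo_leq => // [x y' z|n]; first exact: le_trans.
by rewrite big_ord_recr lerDl mulr_ge0 ?rnorm_ge0.
Qed.

(** The exact weight is chosen for [t], as then the remainders of the
    representation have small nuclear norm by [nuclear_le_remainder]. *)
Lemma exact_weight T f y r : represents T f y r ->
  exists t, [/\ t <= r, represents T f y t & forall e, 0 < e ->
    \forall n \near \oo, t - \sum_(k < n) rnorm (f k) * rnorm (y k) < e].
Proof.
move=> [Tfy fr]; pose t := fine (representation_sum f y).
have tE : representation_sum f y = t%:E.
  by rewrite fineK// ge0_fin_numE ?representation_sum_ge0//; case: Tfy.
exists t; split=> [||e e0]; first by rewrite -lee_fin -tE.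
  by rewrite /represents tE.
apply: contrapT => H.
have : (representation_sum f y <= (t - e)%:E)%E.
  apply/representation_sum_leP => n; rewrite leNgt; apply/negP => tn; apply: H.
  exists n => // m /= nm; rewrite ltrBlDl -ltrBlDr (lt_le_trans tn)//.
  exact: weights_nondecreasing.
by rewrite tE lee_fin lerBrDr gerDl leNgt e0.
Qed.

Lemma op_le_nuclear T r x : nuclear_le T r -> rnorm (T x) <= r * rnorm x.
Proof.
move=> [f [y /representsP[_ _ fr Tfy]]]; apply/ler_addgt0Pr => e e0.
have /cvg_rnormP/(_ e e0)/filter_ex[n Tn] := Tfy x.
rewrite -[T x](subrK (\sum_(k < n) (f k x : K) *: y k)) addrC.
rewrite (le_trans (ler_rnormD _ _))// lerD//; last exact: ltW.
rewrite (le_trans (ler_rnorm_sum _ _))//.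
apply: (@le_trans _ _ ((\sum_(k < n) rnorm (f k) * rnorm (y k)) * rnorm x)).
  rewrite mulr_suml ler_sum// => k _; rewrite rnormZ mulrAC ler_wpM2r ?rnorm_ge0//.
  exact: rnorm_op.
by rewrite ler_wpM2r ?rnorm_ge0.
Qed.

End NuclearCalculus.

(** * Projected representations and stable norm attainment *)

Section Projections.
Context (R : realType) (s : scalars).
Local Notation K := (scalar_field R s).
Variables X Y : normedModType K.

(** [P] acts on functionals and is not continuous for pointwise convergence, so
    [represents T f y r] alone does not determine the sum of the [P f_k (x) Q y_k].
    But for [g] in the dual of [Y], [g \o Q \o T = g \o T] is the limit in norm of
    the partial sums of [g (Q y_k) f_k], and it is a combination of the [m_k],
    which [P] fixes.  Applying [P] identifies [g] of the new sum with [g \o T],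
    uniformly in [g], and norming functionals conclude. *)
Lemma represents_projected (T : bounded_op X Y) f y r
    (n : nat) (m : 'I_n -> dual X) (v : 'I_n -> Y)
    (P : bounded_op (dual X) (dual X)) (Q : bounded_op Y Y) :
  T = \sum_k tensor (m k) (v k) ->
  rnorm P <= 1 -> rnorm Q <= 1 ->
  (forall k, P (m k) = m k) -> (forall k, Q (v k) = v k) ->
  represents T f y r -> represents T (fun k => P (f k)) (fun k => Q (y k)) r.
Proof.
move=> TE P1 Q1 Pm Qv /exact_weight[t [tr Tt tail]].
have /representsP[[C fC] [D yD] fr _] := Tt.
apply/representsP; split.
- by exists C => k; rewrite (le_trans (rnorm_contraction _ P1)).
- by exists D => k; rewrite (le_trans (rnorm_contraction _ Q1)).
- move=> N; apply: le_trans tr; apply: le_trans (fr N).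
  by apply: ler_sum => k _; rewrite ler_pM ?rnorm_ge0 ?rnorm_contraction.
move=> x; apply/cvg_rnormP => e e0.
have x10 : 0 < 2 * (rnorm x + 1) by rewrite mulr_gt0// ltr_wpDl ?rnorm_ge0.
have := tail _ (divr_gt0 e0 x10); apply: filterS => N /= tN.
set w := T x - _; set d := t - _ in tN.
have [g [g2 gw]] := norming_functional w.
have dT := nuclear_le_remainder N Tt; rewrite -/d in dT.
have d0 := nuclear_le_ge0 dT.
(* The remainder of [g \o Q \o T], to which [P] is applied. *)
pose phi : dual X := \sum_k (g (v k) : K) *: m k -
  \sum_(k < N) (g (Q (y k)) : K) *: f k.
have phiE x' : phi x' = g (Q ((T - \sum_(k < N) tensor (f k) (y k)) x')).
  rewrite /phi !sub_opE !sum_opE TE sum_opE !linearB !linear_sum.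
  congr (_ + _); apply: eq_bigr => k _; rewrite scale_opE tensorE /= !linearZ/= ?Qv.
    exact: (scalar_scaleC (g (v k)) (m k x')).
  by rewrite !scalerN; congr (- _); exact: (scalar_scaleC (g (Q (y k))) (f k x')).
have phi_le : rnorm phi <= 2 * d.
  apply: rnorm_op_le => [|x']; first by rewrite mulr_ge0.
  rewrite phiE (le_trans (rnorm_op _ _))// -mulrA ler_pM ?rnorm_ge0//.
  by rewrite (le_trans (rnorm_contraction _ Q1))// op_le_nuclear.
have gwE : g w = P phi x.
  have -> : P phi = \sum_k (g (v k) : K) *: m k -
      \sum_(k < N) (g (Q (y k)) : K) *: P (f k).
    rewrite /phi linearB; congr (_ - _); rewrite linear_sum;
      by apply: eq_bigr => k _; rewrite linearZ/= ?Pm.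
  rewrite sub_opE !sum_opE /w TE sum_opE linearB.
  congr (_ - _); rewrite linear_sum; apply: eq_bigr => k _; rewrite scale_opE linearZ/=.
    exact: (scalar_scaleC (m k x) (g (v k))).
  exact: (scalar_scaleC (P (f k) x) (g (Q (y k)))).
apply: (le_lt_trans gw); rewrite gwE.
apply: (le_lt_trans (rnorm_op _ _)).
apply: (@le_lt_trans _ _ (2 * d * (rnorm x + 1))).
  rewrite ler_pM ?rnorm_ge0 ?lerDl//.
  by rewrite (le_trans (rnorm_contraction _ P1)).
by rewrite mulrAC mulrC -ltr_pdivlMr.
Qed.

End Projections.

Section NormAttainment.
Context (R : realType) (s : scalars).
Local Notation K := (scalar_field R s).
Local Notation "r %:S" := (of_real s r) (at level 2, format "r %:S").

(** The compactness shared by finite-dimensional subspaces and uniformly convex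
    spaces: sequences on which a functional of norm at most one tends to 1
    accumulate. *)
Definition norming_compact (Y : normedModType K) (N : set Y) :=
  forall (U : set_system nat), UltraFilter U -> forall y : nat -> Y,
  (forall k, N (y k)) -> (forall k, rnorm (y k) = 1) ->
  forall g : Y -> R,
    (forall v w, g (v + w) = g v + g w) ->
    (forall v t, g (t%:S *: v) = t * g v) ->
    (forall v, g v <= rnorm v) ->
    (forall e, 0 < e -> \forall k \near U, 1 - e < g (y k)) ->
  exists y0 : Y, y @ U --> y0.

(** Otherwise there are pairs [(z k, y k)] that satisfy [1 - k.+1^-1 < B (z k) (y k)]
    and stay away from all pairs where [B] is 1.  Along an ultrafilter [z k]
    converges to some [z0]; then [B z0 (y k)] tends to 1, so [y k] converges to
    some [y0], and [B z0 y0 = 1]. *)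
Lemma attainment_stable (Z Y : normedModType K) (M : set Z) (N : set Y) (B : Z -> Y -> R) :
  finite_dim_subspace M -> norming_compact N ->
  (forall z1 z2 y, B (z1 + z2) y = B z1 y + B z2 y) ->
  (forall z y1 y2, B z (y1 + y2) = B z y1 + B z y2) ->
  (forall z y t, B z (t%:S *: y) = t * B z y) ->
  (forall z y, B z y <= rnorm z * rnorm y) ->
  forall e, 0 < e -> exists2 d, 0 < d & forall z y, M z -> N y ->
    rnorm z = 1 -> rnorm y = 1 -> 1 - d < B z y ->
    exists z' y', [/\ rnorm z' <= 1, rnorm y' <= 1, rnorm (z - z') <= e,
      rnorm (y - y') <= e & B z' y' = 1].
Proof.
move=> Mfin Nc BDl BDr BZr B1 e e0; apply: contrapT => H.
have sel (n : nat) : exists zy : Z * Y, [/\ M zy.1, N zy.2, rnorm zy.1 = 1, rnorm zy.2 = 1 &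
    1 - n.+1%:R^-1 < B zy.1 zy.2 /\
    ~ exists z' y', [/\ rnorm z' <= 1, rnorm y' <= 1, rnorm (zy.1 - z') <= e,
      rnorm (zy.2 - y') <= e & B z' y' = 1]].
  apply: contrapT => Hn; apply: H; exists n.+1%:R^-1 => // z y Mz Ny z1 y1 Bzy.
  by apply: contrapT => Hzy; apply: Hn; exists (z, y).
have /choice[zy zyP] := sel.
pose z k := (zy k).1; pose y k := (zy k).2.
have Mz k : M (z k) by case: (zyP k).
have Ny k : N (y k) by case: (zyP k).
have z1 k : rnorm (z k) = 1 by case: (zyP k).
have y1 k : rnorm (y k) = 1 by case: (zyP k).
have [U UU ooU] := ultra_oo; have FU := @ultra_proper _ _ UU.
have [z0 zz0] : exists z0 : Z, z @ U --> z0.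
  by apply: (finite_dim_ultra_compact UU Mfin (C := 1)) => // k; rewrite z1.
have {}zz0 r : 0 < r -> \forall k \near U, rnorm (z0 - z k) < r.
  by move: r; apply/cvg_rnormP.
have z01 : rnorm z0 <= 1.
  apply/ler_addgt0Pr => d /zz0/filter_ex[k zk].
  by rewrite -(z1 k) addrC -lerBlDr (le_trans (ler_rnorm_dist _ _))// ltW.
have Bz0 d : 0 < d -> \forall k \near U, 1 - d < B z0 (y k).
  move=> d0; have d20 : 0 < d / 2 by rewrite divr_gt0.
  have ood : \forall k \near U, (k.+1%:R^-1 : R) < d / 2.
    by apply: ooU; exact: near_infty_natSinv_lt (PosNum d20).
  apply: filterS2 (zz0 _ d20) ood => k zk kd.
  have [_ _ _ _ [Bk _]] := zyP k.
  have := B1 (z k - z0) (y k).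
  rewrite y1 mulr1 rnormBC.
  have -> : B (z k - z0) (y k) = B (z k) (y k) - B z0 (y k).
    by apply/eqP; rewrite eq_sym subr_eq -BDl subrK.
  move=> hB; move: hB zk kd Bk; rewrite /z /y /=.
  by move: (k.+1%:R^-1) (rnorm _) (B _ _) (B _ _) => a1 a2 a3 a4 *; lra.
have [y0 yy0] : exists y0 : Y, y @ U --> y0.
  apply: (Nc U UU y Ny y1 (B z0)) => // v; apply: le_trans (B1 z0 v) _.
  by rewrite ler_piMl ?rnorm_ge0.
have {}yy0 r : 0 < r -> \forall k \near U, rnorm (y0 - y k) < r.
  by move: r; apply/cvg_rnormP.
have y01 : rnorm y0 <= 1.
  apply/ler_addgt0Pr => d /yy0/filter_ex[k yk].
  by rewrite -(y1 k) addrC -lerBlDr (le_trans (ler_rnorm_dist _ _))// ltW.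
have B01 : B z0 y0 = 1.
  apply/eqP; rewrite eq_le (le_trans (B1 _ _)) ?mulr_ile1 ?rnorm_ge0//=.
  apply/ler_addgt0Pr => d d0; have d20 : 0 < d / 2 by rewrite divr_gt0.
  have [k [yk Bk]] := filter_ex (filterI (yy0 _ d20) (Bz0 _ d20)).
  have := B1 z0 (y k - y0); rewrite (rnormBC (y k)).
  have -> : B z0 (y k - y0) = B z0 (y k) - B z0 y0.
    by apply/eqP; rewrite eq_sym subr_eq -BDr subrK.
  have : rnorm z0 * rnorm (y0 - y k) <= rnorm (y0 - y k) by rewrite ler_piMl ?rnorm_ge0.
  move: yk Bk => /= yk Bk; move: yk Bk; lra.
have [k [zk yk]] := filter_ex (filterI (zz0 _ e0) (yy0 _ e0)).
have [_ _ _ _ [_]] := zyP k; apply.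
by exists z0, y0; split=> //; rewrite rnormBC ltW.
Qed.

End NormAttainment.

(** * Density for finite tensors *)

Section Density.
Context (R : realType) (s : scalars).
Local Notation K := (scalar_field R s).
Local Notation "r %:S" := (of_real s r) (at level 2, format "r %:S").
Variables X Y : normedModType K.
Implicit Types (T S : bounded_op X Y).

Definition contractive_projection (Z : normedModType K) (M : set Z) (P : bounded_op Z Z) :=
  [/\ rnorm P <= 1, forall z, M (P z) & forall z, M z -> P z = z].

Section Perturbation.
Variables (u : bounded_op X Y -> R) (M : set (dual X)) (N : set Y).
Local Notation B f y := (u (tensor f y)).
Hypothesis BZ : forall (a b : R) f y, B (a%:S *: f) (b%:S *: y) = a * b * B f y.
Hypothesis MZ : forall (t : R) f, M f -> M (t%:S *: f).
Hypothesis NZ : forall (t : R) y, N y -> N (t%:S *: y).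
Hypothesis B1 : forall f y, B f y <= rnorm f * rnorm y.
Variables (e d : R).
Hypotheses (e0 : 0 < e) (d0 : 0 < d).
Hypothesis stable : forall f y, M f -> N y -> rnorm f = 1 -> rnorm y = 1 ->
  1 - d < B f y -> exists f' y', [/\ rnorm f' <= 1, rnorm y' <= 1,
    rnorm (f - f') <= e, rnorm (y - y') <= e & B f' y' = 1].

(** With [l] the weight of [tensor f y], the error is [2 * e * l] if
    [(1 - d) * l < B f y], by moving to a pair where [u] is exactly normed.
    Otherwise the term is dropped, with an error [l <= (l - B f y) / d].  Summed
    over an almost optimal representation both contributions are small. *)
Lemma perturb_tensor f y : M f -> N y -> exists f' y',
  rnorm f' * rnorm y' <= B f' y' /\
  nuclear_le (tensor f y - tensor f' y')
    (2 * e * (rnorm f * rnorm y) + (rnorm f * rnorm y - B f y) / d).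
Proof.
move=> Mf Ny; set l := rnorm f * rnorm y.
have l0 : 0 <= l by rewrite mulr_ge0 ?rnorm_ge0.
have lB : 0 <= (l - B f y) / d by rewrite divr_ge0 ?(ltW d0)// subr_ge0.
have le0 : 0 <= 2 * e * l by rewrite mulr_ge0// mulr_ge0// ltW.
have [good|bad] := ltP ((1 - d) * l) (B f y); last first.
  exists 0, 0; have B0 : tensor 0 0 = 0 :> bounded_op X Y.
    by apply: bounded_op_ext => x; rewrite tensorE scaler0 zero_opE.
  split.
    have := BZ 0 0 0 0; rewrite mul0r mul0r !of_real0 !scale0r => ->.
    by rewrite rnorm0 mul0r.
  rewrite B0 subr0; apply: nuclear_le_mono (nuclear_le_tensor f y) _.
  rewrite -/l -[leLHS]add0r lerD// ler_pdivlMr//.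
  by move: bad; lra.
have ln0 : l != 0.
  apply: contraTneq good => l00; rewrite l00 mulr0 -leNgt.
  by apply: le_trans (B1 _ _) _; rewrite -/l l00.
have f0 : f != 0 by apply: contraNneq ln0 => f0; rewrite /l f0 rnorm0 mul0r.
have y0 : y != 0 by apply: contraNneq ln0 => y0; rewrite /l y0 rnorm0 mulr0.
have [f1 f11 fE] := unit_rescale f0; have [y1 y11 yE] := unit_rescale y0.
have lgt0 : 0 < l by rewrite lt_neqAle eq_sym ln0.
have Mf1 : M f1.
  have -> : f1 = (rnorm f)^-1%:S *: f.
    by rewrite [in X in _ *: X]fE scalerA -of_realM mulVf ?rnorm_eq0// of_real1 scale1r.
  exact: MZ.
have Ny1 : N y1.
  have -> : y1 = (rnorm y)^-1%:S *: y.
    by rewrite [in X in _ *: X]yE scalerA -of_realM mulVf ?rnorm_eq0// of_real1 scale1r.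
  exact: NZ.
have B11 : 1 - d < B f1 y1.
  by move: good; rewrite fE yE BZ -/l mulrC ltr_pM2l.
have [f2 [y2 [f21 y21 f12 y12 B2]]] := stable Mf1 Ny1 f11 y11 B11.
exists (l%:S *: f2), y2; split.
  have := BZ l 1 f2 y2; rewrite of_real1 scale1r mulr1 B2 mulr1 => ->.
  by rewrite rnormZr ger0_norm// -mulrA ler_piMr// mulr_ile1 ?rnorm_ge0.
apply: (@nuclear_le_mono _ _ _ _ _ (2 * e * l)); last by rewrite lerDl.
have -> : tensor f y - tensor (l%:S *: f2) y2 =
    l%:S *: (tensor (f1 - f2) y1 + tensor f2 (y1 - y2)).
  rewrite tensorBl tensorBr addrA subrK scalerBr tensorZl; congr (_ - _).
  by rewrite {1}fE {1}yE tensorZl tensorZr scalerA -of_realM.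
have := nuclear_leZ l%:S
  (nuclear_leD (nuclear_le_tensor (f1 - f2) y1) (nuclear_le_tensor f2 (y1 - y2))).
rewrite norm_of_real of_realK ger0_norm// => /nuclear_le_mono; apply.
rewrite [leRHS]mulrC ler_pM2l// mulr_natl mulr2n lerD//.
  by rewrite y11 mulr1.
by rewrite -[leRHS]mul1r ler_pM ?rnorm_ge0.
Qed.

End Perturbation.

Lemma finite_tensor_approx (n : nat) (m : 'I_n -> dual X) (v : 'I_n -> Y)
    (M : set (dual X)) (N : set Y) P Q e :
  finite_dim_subspace M -> norming_compact N ->
  contractive_projection M P -> contractive_projection N Q ->
  (forall k, M (m k)) -> (forall k, N (v k)) -> 0 < e ->
  exists2 S, nuclear_norm_attaining S &
    nuclear_le (\sum_k tensor (m k) (v k) - S) e.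
Proof.
move=> Mfin Nc [P1 MP PM] [Q1 NQ QN] Mm Nv e0.
set T := \sum_k tensor (m k) (v k).
pose E := [set r : R | nuclear_le T r].
have E0 : lbound E 0 by move=> r; exact: nuclear_le_ge0.
have Einf : has_inf E.
  split; last by exists 0.
  by eexists; apply: nuclear_le_sum => k; exact: nuclear_le_tensor.
set p0 := inf E.
have p00 : 0 <= p0 by apply: lb_le_inf => //; exact: Einf.1.
have T_dom : epi_dom (@nuclear_le R s X Y) T by have [r] := Einf.1; exists r.
have p0_lb r : nuclear_le T r -> p0 <= r by move=> Tr; apply: ge_inf => //; exact: Einf.2.
have [u [uD uZ u1 /(_ T_dom) uT]] := hahn_banach (nuclear_epigraph X Y) p0_lb.
have dt f y : epi_dom (@nuclear_le R s X Y) (tensor f y).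
  by exists (rnorm f * rnorm y); exact: nuclear_le_tensor.
have dsum k (F : 'I_k -> bounded_op X Y) :
    (forall i, epi_dom (@nuclear_le R s X Y) (F i)) ->
    epi_dom (@nuclear_le R s X Y) (\sum_i F i).
  by move=> /choice[r Fr]; exists (\sum_i r i); exact: nuclear_le_sum.
have usum k (F : 'I_k -> bounded_op X Y) :
    (forall i, epi_dom (@nuclear_le R s X Y) (F i)) -> u (\sum_i F i) = \sum_i u (F i).
  elim: k F => [|k IH] F dF.
    have d00 : epi_dom (@nuclear_le R s X Y) 0 by exists 0; exact: nuclear_le0.
    by rewrite !big_ord0 -(scaler0 _ 0%:S) uZ// mul0r.
  by rewrite !big_ord_recr/= uD ?IH//; apply: dsum => i; exact: dF.
have B1 f y : u (tensor f y) <= rnorm f * rnorm y.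
  by apply: u1; exact: nuclear_le_tensor.
have BZ a b f y : u (tensor (a%:S *: f) (b%:S *: y)) = a * b * u (tensor f y).
  by rewrite tensorZl tensorZr scalerA -of_realM uZ.
(* The weight of the representation will be at most [p0 + 1], so moving its
   pairs by [e1] costs at most [e / 2]. *)
pose e1 := e / (4 * (p0 + 1)).
have p10 : 0 < 4 * (p0 + 1) by rewrite mulr_gt0// ltr_wpDl.
have e10 : 0 < e1 by rewrite divr_gt0.
have BDl f g y : u (tensor (f + g) y) = u (tensor f y) + u (tensor g y).
  by rewrite tensorDl uD.
have BDr f y z : u (tensor f (y + z)) = u (tensor f y) + u (tensor f z).
  by rewrite tensorDr uD.
have BZr f y t : u (tensor f (t%:S *: y)) = t * u (tensor f y).
  by rewrite tensorZr uZ.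
have [d d0 stable] := attainment_stable Mfin Nc BDl BDr BZr B1 e10.
have MZ t f : M f -> M (t%:S *: f).
  by move=> Mf; rewrite -(PM f Mf) -linearZ; exact: MP.
have NZ t y : N y -> N (t%:S *: y).
  by move=> Ny; rewrite -(QN y Ny) -linearZ; exact: NQ.
(* [h] bounds the excess of the weight over the nuclear norm of [T]; the dropped
   terms then cost at most [h / d]. *)
pose h := Num.min 1 (Num.min (e / 4) (d * e / 4)).
have h0 : 0 < h by rewrite !lt_min ltr01 !divr_gt0 ?mulr_gt0 ?ltr0n//.
have h1 : h <= 1 by rewrite ge_min lexx.
have h2 : h <= e / 4 by rewrite !ge_min lexx orbT.
have h3 : h <= d * e / 4 by rewrite !ge_min lexx !orbT.
have [r [f [y Tfy]] rp] := inf_adherent h0 Einf.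
have {}Tfy := represents_projected (erefl T) P1 Q1
  (fun k => PM _ (Mm k)) (fun k => QN _ (Nv k)) Tfy.
set f1 := fun k => P (f k) in Tfy; set y1 := fun k => Q (y k) in Tfy.
have [t [tr Tt tail]] := exact_weight Tfy.
have [c /= tc] := filter_ex (tail _ h0).
have Trem := nuclear_le_remainder c Tt.
set w := \sum_(k < c) _ in tc Trem.
have /choice[f2 /choice[y2 fy2]] k := @perturb_tensor u M N BZ MZ NZ B1 e1 d e10 d0
  stable (f1 k) (y1 k) (MP _) (NQ _).
pose f3 k := if (k < c)%N then f2 k else 0; pose y3 k := if (k < c)%N then y2 k else 0.
pose S := \sum_(k < c) tensor (f3 k) (y3 k).
have fy3 (k : 'I_c) : f3 k = f2 k /\ y3 k = y2 k by rewrite /f3 /y3 ltn_ord.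
have uS : \sum_(k < c) rnorm (f3 k) * rnorm (y3 k) <= u S.
  rewrite usum// ler_sum// => k _; have [-> ->] := fy3 k.
  by case: (fy2 k).
exists S.
  have Srep : represents S f3 y3 (\sum_(k < c) rnorm (f3 k) * rnorm (y3 k)).
    by apply: represents_finite => k ck; rewrite /f3 /y3 ltnNge ck.
  exists f3, y3; split; first exact: Srep.1.
  apply/eqP; rewrite eq_le; apply/andP; split.
    by apply: ereal_inf_lbound; exists f3, y3; split=> //; exact: Srep.1.
  apply/ereal_infP => _ [g [z [Sgz ->]]].
  apply: le_trans Srep.2 _.
  have gz : representation_sum g z \is a fin_num.
    by rewrite ge0_fin_numE ?representation_sum_ge0//; case: Sgz.
  rewrite -(fineK gz) lee_fin; apply: le_trans uS _; apply: u1.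
  by exists g, z; split=> //; rewrite fineK.
have -> : T - S = (T - \sum_(k < c) tensor (f1 k) (y1 k)) +
    \sum_(k < c) (tensor (f1 k) (y1 k) - tensor (f2 k) (y2 k)).
  rewrite sumrB addrA subrK; congr (_ - _).
  by apply: eq_bigr => k _; have [-> ->] := fy3 k.
apply: nuclear_le_mono (nuclear_leD Trem (nuclear_le_sum (fun k : 'I_c => (fy2 k).2))) _.
rewrite big_split -mulr_sumr -mulr_suml sumrB -/w.
set b := \sum_(k < c) u _.
have wb : w - b <= h.
  have : u T <= b + (t - w).
    have <- : u (T - \sum_(k < c) tensor (f1 k) (y1 k)) + b = u T.
      rewrite /b -usum// -uD ?subrK//; first by exists (t - w).
      exact: dsum.
    by rewrite addrC lerD2l; exact: u1.
  move: uT rp tr; rewrite -/p0; lra.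
have wp : w <= p0 + 1.
  have := nuclear_le_ge0 Trem; move: rp tr h1; rewrite -/p0; lra.
have -> : e = e / 4 + (e / 2 + e / 4) by field.
rewrite lerD ?lerD//; first by rewrite (le_trans (ltW tc)).
  apply: (@le_trans _ _ (2 * e1 * (p0 + 1))).
    by rewrite ler_wpM2l// mulr_ge0// ltW.
  rewrite le_eqVlt; apply/orP; left; apply/eqP; rewrite /e1.
  by field; rewrite gt_eqF// ltr_wpDl.
rewrite ler_pdivrMr// (le_trans wb)//; apply: le_trans h3 _.
by rewrite (mulrC d) mulrAC.
Qed.

End Density.

(** * The two classes of range spaces *)

Section ApproximatingSubspaces.
Context (R : realType) (s : scalars).
Local Notation K := (scalar_field R s).
Local Notation "r %:S" := (of_real s r) (at level 2, format "r %:S").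

Lemma one_complementedP (Z : normedModType K) (M : set Z) :
  one_complemented M -> exists P, contractive_projection M P.
Proof.
move=> [P [PP P1 ->]]; exists P; split=> [|z|_ [z _ <-]].
- by rewrite -(of_real_le s) -rnormE of_real1.
- by exists z.
- exact: PP.
Qed.

(** The defining property speaks of unit vectors only: rescale, replacing null
    vectors by an arbitrary unit vector. *)
Lemma metric_pi_approx (Z : normedModType K) : metric_pi_property Z ->
  forall n (z : 'I_n -> Z) e, 0 < e -> exists M P z',
    [/\ finite_dim_subspace M, contractive_projection M P, forall k, M (z' k) &
      forall k, rnorm (z k - z' k) <= e].
Proof.
move=> piZ n z e e0.
pose A := \sum_k rnorm (z k) + 1.
have A0 : 0 < A by rewrite ltr_wpDl// sumr_ge0// => k _; exact: rnorm_ge0.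
have zA k : rnorm (z k) <= A.
  rewrite /A (bigD1 k)//= -addrA lerDl addr_ge0// sumr_ge0// => j _; exact: rnorm_ge0.
have eA0 : 0 < (e / A)%:S :> K by rewrite of_real_gt0 divr_gt0.
have [[w w1]|no_unit] := pselect (exists w : Z, rnorm w = 1); last first.
  (* Without unit vectors the space is trivial. *)
  have z0 k : z k = 0.
    apply: contrapT => /eqP/unit_rescale[w w1 _].
    by apply: no_unit; exists w.
  have [M [Mfin /one_complementedP[P cP] _]] := piZ _ 0 (fun=> 0) eA0 (fun k => ltac:(by case: k)).
  exists M, P, (fun=> P 0); split=> // k; first by case: cP.
  by rewrite z0 linear0 subrr rnorm0 ltW.
have unit k : exists v : Z, rnorm v = 1 /\ z k = (rnorm (z k))%:S *: v.
  have [->|/unit_rescale[v v1 vE]] := eqVneq (z k) 0; last by exists v.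
  by exists w; rewrite rnorm0 of_real0 scale0r.
have /choice[v vP] := unit.
have v1 k : `|v k| = 1 by rewrite rnormE (vP k).1 of_real1.
have [M [Mfin /one_complementedP[P cP] near_v]] := piZ _ n v eA0 v1.
have /choice[v' v'P] : forall k, exists v', M v' /\ rnorm (v k - v') < e / A.
  move=> k; have [v' Mv' vv'] := near_v k; exists v'; split=> //.
  by rewrite -(of_real_lt s) -rnormE.
exists M, P, (fun k => (rnorm (z k))%:S *: v' k); split=> // k.
  by have [_ MP PM] := cP; rewrite -(PM _ (v'P k).1) -linearZ; exact: MP.
rewrite {1}(vP k).2 -scalerBr rnormZr ger0_norm ?rnorm_ge0//.
apply: (@le_trans _ _ (A * (e / A))); last by rewrite mulrC divfK ?gt_eqF.
by rewrite ler_pM ?rnorm_ge0// ltW// (v'P k).2.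
Qed.

Lemma finite_dim_norming_compact (Y : normedModType K) (N : set Y) :
  finite_dim_subspace N -> norming_compact N.
Proof.
move=> Nfin U UU y Ny y1 _ _ _ _ _.
by apply: (finite_dim_ultra_compact UU Nfin (C := 1)) => // k; rewrite y1.
Qed.

(** If [1 - d < g v] and [1 - d < g w] then [1 - d < g ((v + w) / 2)], so the
    midpoint of [v] and [w] has norm larger than [1 - d], and uniform convexity
    makes [v] and [w] close.  Hence the sequence is Cauchy. *)
Lemma uniformly_convex_norming_compact (Y : completeNormedModType K) :
  uniformly_convex Y -> norming_compact [set: Y].
Proof.
move=> ucY U UU y _ y1 g gD gZ g1 gy; have FU := @ultra_proper _ _ UU.
apply/cvg_ex; apply: (@cauchy_cvg Y (y @ U)); apply: cauchy_exP => e e0.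
have [d d0 dP] := ucY e e0.
have rd0 : 0 < re d by rewrite -(of_real_gt0 s) reK// ltW.
have near_g := gy _ rd0; have [k gk] := filter_ex near_g.
exists (y k); apply: filterS near_g => j gj; rewrite -ball_normE /=.
rewrite real_ltNge ?normr_real ?gtr0_real//; apply/negP => ekj.
have n1 i : `|y i| = 1 by rewrite rnormE y1 of_real1.
have := dP _ _ (n1 k) (n1 j) ekj.
have -> : (2^-1 : K) = (2^-1)%:S by rewrite of_realV of_realD of_real1.
rewrite rnormE -of_real1 -(reK (ltW d0)) -of_realB of_real_le => half.
have := le_trans (g1 _) half; rewrite gZ gD => hg.
move: gk gj hg; lra.
Qed.

Definition approximable_by_norming_compact (Y : normedModType K) :=
  forall n (y : 'I_n -> Y) e, 0 < e -> exists N Q v,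
    [/\ norming_compact N, contractive_projection N Q, forall k, N (v k) &
      forall k, rnorm (y k - v k) <= e].

Lemma metric_pi_approximable (Y : normedModType K) :
  metric_pi_property Y -> approximable_by_norming_compact Y.
Proof.
move=> piY n y e e0; have [N [Q [v [Nfin cQ Nv yv]]]] := metric_pi_approx piY y e0.
by exists N, Q, v; split=> //; exact: finite_dim_norming_compact.
Qed.

Lemma uniformly_convex_approximable (Y : completeNormedModType K) :
  uniformly_convex Y -> approximable_by_norming_compact Y.
Proof.
move=> ucY n y e e0.
have lid : linear (fun x : Y => x) by [].
have bid (x : Y) : rnorm x <= 1 * rnorm x by rewrite mul1r.
exists setT, (mk_op lid bid), y; split=> //.
- exact: uniformly_convex_norming_compact.
- by split=> //; apply: rnorm_op_le => //; exact: bid.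
- by move=> k; rewrite subrr rnorm0 ltW.
Qed.

Lemma nuclear_norm_attaining_dense (X Y : normedModType K) :
  metric_pi_property (dual X) -> approximable_by_norming_compact Y ->
  nuclear_closure (@nuclear_norm_attaining R s X Y) = @nuclear R s X Y.
Proof.
move=> piX apY; apply/seteqP; split=> [T []//|T nT]; split=> // eps eps0.
pose e := eps / 4; have e0 : 0 < e by rewrite divr_gt0.
have /nuclearP[r [f [y /exact_weight[t [_ Tt tail]]]]] := nT.
have /representsP[[C fC] [D yD] _ _] := Tt.
have C0 : 0 <= C by exact: le_trans (rnorm_ge0 _) (fC 0).
have D0 : 0 <= D by exact: le_trans (rnorm_ge0 _) (yD 0).
have [n /= tn] := filter_ex (tail _ e0).
have Trem := nuclear_le_remainder n Tt.
pose L := n.+1%:R * (C + D + 1).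
have L0 : 0 < L by rewrite mulr_gt0// ltr_wpDl// addr_ge0.
pose e1 := Num.min 1 (e / L).
have e10 : 0 < e1 by rewrite lt_min ltr01 divr_gt0.
have e11 : e1 <= 1 by rewrite ge_min lexx.
have e1L : e1 <= e / L by rewrite ge_min lexx orbT.
have [M [P [m [Mfin cP Mm fm]]]] := metric_pi_approx piX (fun k : 'I_n => f k) e10.
have [N [Q [v [Nc cQ Nv yv]]]] := apY _ (fun k : 'I_n => y k) _ e10.
have [S AS TS] := finite_tensor_approx Mfin Nc cP cQ Mm Nv e0.
exists S => //.
have close : nuclear_le
    (\sum_(k < n) (tensor (f k) (y k) - tensor (m k) (v k))) e.
  have term (k : 'I_n) : nuclear_le (tensor (f k) (y k) - tensor (m k) (v k))
      (e1 * (C + D + 1)).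
    have -> : tensor (f k) (y k) - tensor (m k) (v k) =
        tensor (f k - m k) (y k) + tensor (m k) (y k - v k).
      by rewrite tensorBl tensorBr addrA subrK.
    apply: nuclear_le_mono (nuclear_leD (nuclear_le_tensor _ _) (nuclear_le_tensor _ _)) _.
    have mC : rnorm (m k) <= C + 1.
      rewrite -[m k](subrK (f k)) addrC (le_trans (ler_rnormD _ _))// lerD//.
      by rewrite rnormBC (le_trans (fm k)).
    have := ler_pM (rnorm_ge0 _) (rnorm_ge0 _) (fm k) (yD k).
    have := ler_pM (rnorm_ge0 _) (rnorm_ge0 _) mC (yv k).
    lra.
  apply: nuclear_le_mono (nuclear_le_sum term) _.
  rewrite sumr_const card_ord -mulr_natl.
  apply: (@le_trans _ _ (e1 * L)); last by rewrite -ler_pdivlMr.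
  rewrite /L mulrCA ler_pM2l// ler_wpM2r ?ler_nat// !addr_ge0//.
have TSE : T - S = (T - \sum_(k < n) tensor (f k) (y k)) +
    (\sum_(k < n) (tensor (f k) (y k) - tensor (m k) (v k)) +
     (\sum_(k < n) tensor (m k) (v k) - S)).
  by rewrite sumrB !subrKA.
have := nuclear_leD Trem (nuclear_leD close TS).
rewrite -TSE => /nuclear_norm_leP/le_lt_trans; apply.
by rewrite lte_fin; move: tn; rewrite /e; lra.
Qed.

End ApproximatingSubspaces.

Theorem corollary4p9 (R : realType) (s : scalars)
    (X Y : completeNormedModType (scalar_field R s))
    (hX : metric_pi_property (dual X)) :
  (metric_pi_property Y ->
     nuclear_closure (@nuclear_norm_attaining R s X Y) = @nuclear R s X Y) /\
  (uniformly_convex Y ->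
     nuclear_closure (@nuclear_norm_attaining R s X Y) = @nuclear R s X Y).
Proof.
split=> [piY|ucY]; apply: nuclear_norm_attaining_dense => //.
- exact: metric_pi_approximable.
- exact: uniformly_convex_approximable.
Qed.
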